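(* For all $n\ge1$, $\dim\tilde H_{n-1}(PCP_n^-\ast C_n)=d_n^{BC}$.
   Context: $PCP_n$ is the poset of proper faces (including the empty face) of the $n$-dimensional cross-polytope, ordered by inclusion; equivalently, identifying vertices with $[n]\cup\{\bar1,\dots,\bar n\}$, it is the poset of subsets of $[n]\cup\{\bar1,\dots,\bar n\}$ containing no pair $\{i,\bar i\}$, ranked by cardinality (length $n$). $PCP_n^-=PCP_n\setminus\{\emptyset\}$. $C_n$ is the chain $1<\dots<n$. For ranked posets $P,Q$ with rank functions $r_P,r_Q$ (minimal elements of rank $0$), the Rees product $P\ast Q=\{(p,q):r_P(p)\ge r_Q(q)\}$, with $(p_1,q_1)\le(p_2,q_2)$ iff $p_1\le p_2$, $q_1\le q_2$, and $r_P(p_2)-r_P(p_1)\ge r_Q(q_2)-r_Q(q_1)$. $\tilde H$ is reduced homology of the order complex over $\mathbb C$. The hyperoctahedral group $\mathfrak S_n[\mathbb Z_2]$ acts on the $2n$ vertices $[n]\cup\{\bar1,\dots,\bar n\}$ (permutations $\sigma$ send $i\mapsto\sigma(i)$, $\bar i\mapsto\overline{\sigma(i)}$; the $i$-th sign change swaps $i$ and $\bar i$ and fixes the rest); $d_n^{BC}$ is the number of elements of this group fixing no vertex. *)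

(* Defs.v *)
From HB Require Import structures.
From mathcomp Require Import all_boot all_order all_algebra all_fingroup.
From mathcomp Require Import reals complex.

Set Implicit Arguments.
Unset Strict Implicit.
Unset Printing Implicit Defensive.

Import Order.TTheory GRing.Theory.

Local Open Scope ring_scope.

(* Finite ranked posets: minimal elements have rank 0 and the rank goes up by
   one along each cover relation, which determines the rank function.         *)
HB.mixin Record FinPOrder_isRanked (d : Order.disp_t) T
    of Order.FinPOrder d T := {
  prank : T -> nat;
  prank_minimal : forall x : T,
    (forall y : T, ~~ (y < x)%O) -> prank x = 0%N;
  prank_cover : forall x y : T,
    (x < y)%O -> (forall z : T, ~~ (x < z < y)%O) -> prank y = (prank x).+1
}.

#[short(type="finRankedPOrderType")]
HB.structure Definition FinRankedPOrder (d : Order.disp_t) :=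
  { T of Order.FinPOrder d T & FinPOrder_isRanked d T }.

Section ReesProduct.
Variables (d1 d2 : Order.disp_t).
Variables (P : finRankedPOrderType d1) (Q : finRankedPOrderType d2).

Record rees := Rees {
  rees_pair : P * Q;
  rees_rank : (prank rees_pair.2 <= prank rees_pair.1)%N
}.

HB.instance Definition _ := [isSub of rees for rees_pair].
HB.instance Definition _ := [Finite of rees by <:].

(* The rank differences are taken in int, so there is no truncation. *)
Definition rees_le (u v : rees) : bool :=
  let: (p1, q1) := rees_pair u in let: (p2, q2) := rees_pair v in
  [&& (p1 <= p2)%O, (q1 <= q2)%O &
      (prank q2)%:Z - (prank q1)%:Z <= (prank p2)%:Z - (prank p1)%:Z].

Lemma rees_le_refl : reflexive rees_le.
Proof. by case=> -[p q] h; rewrite /rees_le /= !lexx !subrr. Qed.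

Lemma rees_le_anti : antisymmetric rees_le.
Proof.
move=> [[p1 q1] h1] [[p2 q2] h2]; rewrite /rees_le /=.
case/andP=> /and3P[p12 q12 _] /and3P[p21 q21 _]; apply: val_inj => /=.
by congr pair; apply: le_anti; rewrite ?p12 ?q12.
Qed.

Lemma rees_le_trans : transitive rees_le.
Proof.
move=> [[p2 q2] h2] [[p1 q1] h1] [[p3 q3] h3]; rewrite /rees_le /=.
case/and3P=> p12 q12 r12 /and3P[p23 q23 r23].
rewrite (le_trans p12 p23) (le_trans q12 q23) /=.
by have := Num.Theory.lerD r23 r12; rewrite !addrA !subrK.
Qed.

Fact rees_display : Order.disp_t. Proof. exact: Order.Disp tt tt. Qed.

HB.instance Definition _ := Order.Le_isPOrder.Build rees_display rees
  rees_le_refl rees_le_anti rees_le_trans.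

End ReesProduct.

Section OrderComplex.
Variables (K : fieldType) (d : Order.disp_t) (T : finPOrderType d).

Definition is_chain (c : {set T}) : bool :=
  [forall x in c, forall y in c, (x >=< y)%O].

(* Faces of the order complex with k vertices, i.e. of dimension k - 1; k = 0
   gives the empty face, whence the augmentation of the reduced complex.      *)
Record face (k : nat) := Face {
  face_set :> {set T};
  face_chain : is_chain face_set && (#|face_set| == k)
}.

HB.instance Definition _ k := [isSub of face k for @face_set k].
HB.instance Definition _ k := [Finite of face k by <:].

Definition schain (k : nat) := {ffun face k -> K^o}.

HB.instance Definition _ k := Vector.on (schain k).

Definition below (c : {set T}) (x : T) : nat := #|[set y in c | (y < x)%O]|.

(* On basis elements, x_0 < ... < x_k is sent to the alternating sum over i of
   (-1)^i times the chain with x_i deleted.                                   *)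
Definition bd_fun (k : nat) (a : schain k.+1) : schain k :=
  [ffun e : face k => \sum_(c : face k.+1)
     \sum_(x in face_set c | face_set c :\ x == face_set e)
       (-1) ^+ below c x * a c].

Lemma bd_fun_is_semilinear k : semilinear (@bd_fun k).
Proof.
split=> [l a | a b]; apply/ffunP=> e; rewrite !ffunE /=.
- rewrite scaler_sumr; apply: eq_bigr => c _; rewrite scaler_sumr.
  by apply: eq_bigr => x _; rewrite ffunE /GRing.scale /= mulrCA.
- rewrite -big_split /=; apply: eq_bigr => c _; rewrite -big_split /=.
  by apply: eq_bigr => x _; rewrite ffunE mulrDr.
Qed.

HB.instance Definition _ k :=
  GRing.isSemilinear.Build K (schain k.+1) (schain k) _ (@bd_fun k)
    (@bd_fun_is_semilinear k).

Definition bd (k : nat) : 'Hom(schain k.+1, schain k) := linfun (@bd_fun k).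

Lemma below_setD1 (c : {set T}) x y : x \in c ->
  below c y = ((x < y)%O + below (c :\ x) y)%N.
Proof.
move=> xc; rewrite /below (cardsD1 x) inE xc /=; congr (_ + #|pred_of_set _|)%N.
by apply/setP=> z; rewrite !inE andbA.
Qed.

Lemma face_setD1 k (c : face k.+1) x : x \in face_set c ->
  is_chain (face_set c :\ x) && (#|face_set c :\ x| == k).
Proof.
case: c => c /= /andP[/'forall_in_'forall_in_idP ch /eqP cc] xc.
apply/andP; split; last first.
  by move: cc; rewrite (cardsD1 x) xc add1n => -[->].
apply/forall_inP=> y /setD1P[_ yc]; apply/forall_inP=> z /setD1P[_ zc].
exact: ch.
Qed.

Lemma bdK k (a : schain k.+2) : bd k (bd k.+1 a) = 0.
Proof.
rewrite !lfunE /=; apply/ffunP=> e; rewrite !ffunE.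
pose s (c : {set T}) x : K := (-1) ^+ below c x.
transitivity (\sum_(c : face k.+2) a c * (\sum_(y in face_set c)
  \sum_(x in face_set c | (x != y) && (face_set c :\ y :\ x == face_set e))
    s (face_set c :\ y) x * s (face_set c) y)).
  transitivity (\sum_(f : face k.+1) \sum_(c : face k.+2)
     \sum_(y in face_set c | face_set c :\ y == face_set f)
     \sum_(x in face_set f | face_set f :\ x == face_set e)
       s f x * (s c y * a c)).
    apply: eq_bigr => f _.
    under eq_bigr => x _ do rewrite ffunE mulr_sumr.
    rewrite exchange_big /=; apply: eq_bigr => c _.
    under eq_bigr => x _ do rewrite mulr_sumr.
    by rewrite exchange_big.
  rewrite exchange_big /=; apply: eq_bigr => c _; rewrite mulr_sumr.
  under eq_bigr => f _ do rewrite big_mkcondr.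
  rewrite exchange_big /=; apply: eq_bigr => y yc.
  rewrite -big_mkcond /= (big_pred1 (Face (face_setD1 yc))) /=; last first.
    by move=> f; rewrite /= -val_eqE /= eq_sym.
  rewrite mulr_sumr; apply: eq_big => [x|x _].
    by rewrite !inE andbA [_ && (x \in _)]andbC.
  by rewrite mulrA mulrC.
apply: big1 => c _; rewrite [X in _ * X](_ : _ = 0) ?mulr0 //.
have/andP[/'forall_in_'forall_in_idP ch _] := face_chain c.
set F := fun x y => s (face_set c :\ y) x * s (face_set c) y.
have antiF x y : x \in face_set c -> y \in face_set c -> (x < y)%O ->
  F x y + F y x = 0.
  move=> xc yc xy; rewrite /F /s.
  rewrite (below_setD1 y xc) (below_setD1 x yc) xy.
  have -> : (y < x)%O = false by apply/negbTE; rewrite lt_gtF.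
  by rewrite add0n add1n exprS mulN1r mulrN mulrC addNr.
pose A y x := (x < y)%O && (face_set c :\ y :\ x == face_set e).
pose A' y x := (y < x)%O && (face_set c :\ y :\ x == face_set e).
transitivity (\sum_(y in face_set c) \sum_(x in face_set c | A y x) F x y
  + \sum_(y in face_set c) \sum_(x in face_set c | A' y x) F x y).
  rewrite -big_split /=; apply: eq_bigr => y yc.
  rewrite (bigID (fun x => (x < y)%O)) /=; congr (_ + _);
    apply: eq_bigl => x; rewrite /A /A'; case xc: (x \in face_set c) => //=;
    have := ch x xc y yc; case: comparableP => //=; rewrite ?andbF ?andbT //.
rewrite [X in _ + X](exchange_big_dep (mem (face_set c))) /=; last first.
  by move=> ? ? _ /andP[].
rewrite -big_split big1 //= => y yc.
rewrite [X in _ + X](eq_bigl (fun x => (x \in face_set c) && A y x)).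
  by rewrite -big_split big1 //= => x /and3P[xc xy _]; apply: antiF.
move=> x; rewrite /A /A' yc /=.
by congr [&& _, _ & _ == _]; apply/setP=> z; rewrite !inE andbCA.
Qed.

Section Homology.
Variable i : nat.

Definition cycles : {vspace schain i.+1} := lker (bd i).
Definition boundaries : {vspace schain i.+1} := limg (bd i.+1).

Lemma boundaries_sub_cycles : (boundaries <= cycles)%VS.
Proof.
apply/subvP=> _ /memv_imgP[a _ ->].
by rewrite memv_ker bdK.
Qed.

(* The quotient cycles / boundaries, modelled by a complement of the boundaries
   in the cycles; homology_class is then the quotient map, which is linear,
   onto, and has kernel the boundaries.                                       *)
Definition reduced_homology : vectType K := subvs_of (cycles :\: boundaries)%VS.

Definition homology_class : 'Hom(schain i.+1, reduced_homology) :=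
  (linfun (vsproj (cycles :\: boundaries)) \o addv_pi1 cycles boundaries)%VF.

Lemma homology_class_eq0 z : z \in cycles ->
  (homology_class z == 0) = (z \in boundaries).
Proof.
move=> zZ; rewrite /homology_class comp_lfunE lfunE /=.
have pi1D : addv_pi1 cycles boundaries z \in (cycles :\: boundaries)%VS.
  exact: memv_pi.
rewrite -(inj_eq val_inj) /= vsprojK //.
have zZB : z \in (cycles + boundaries)%VS by apply: (subvP (addvSl _ _)).
have dec := addv_pi1_pi2 zZB.
have pi2B : addv_pi2 cycles boundaries z \in boundaries by apply: memv_pi2.
apply/eqP/idP=> [pi10 | zB]; first by rewrite -dec pi10 add0r.
have : addv_pi1 cycles boundaries z \in
    ((cycles :\: boundaries) :&: boundaries)%VS.
  rewrite memv_cap pi1D -[X in X \in _](addrK (addv_pi2 cycles boundaries z)).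
  by rewrite dec rpredB.
by rewrite capv_diff memv0 => /eqP.
Qed.

Lemma homology_class_surj (h : reduced_homology) :
  exists2 z, z \in cycles & homology_class z = h.
Proof.
have hD := subvsP h; exists (val h).
  by apply: (subvP (diffvSl _ _)) hD.
rewrite /homology_class comp_lfunE lfunE /=.
rewrite /addv_pi1 daddv_pi_id ?vsvalK //.
exact: capv_diff.
Qed.

Definition reduced_homology_dim : nat := \dim {: reduced_homology}.

End Homology.
End OrderComplex.

Section CrossPolytope.
Variable n : nat.

(* (i, false) is the vertex i and (i, true) is the vertex \bar i. *)
Definition vertex : Type := ('I_n * bool)%type.
HB.instance Definition _ := Finite.on vertex.

Definition antipode_free (F : {set vertex}) : bool :=
  [forall i : 'I_n, ~~ (((i, false) \in F) && ((i, true) \in F))].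

Lemma antipode_free_sub (F G : {set vertex}) :
  F \subset G -> antipode_free G -> antipode_free F.
Proof.
move=> /subsetP sFG /forallP afG; apply/forallP=> i; apply: contra (afG i).
by case/andP=> /sFG -> /sFG ->.
Qed.

Record pcp := PCP {
  pcp_set :> {set vertex};
  pcp_free : antipode_free pcp_set
}.

HB.instance Definition _ := [isSub of pcp for pcp_set].
HB.instance Definition _ := [Finite of pcp by <:].

Definition pcp_le (F G : pcp) : bool := pcp_set F \subset pcp_set G.

Lemma pcp_le_refl : reflexive pcp_le. Proof. by move=> F; apply: subxx. Qed.

Lemma pcp_le_anti : antisymmetric pcp_le.
Proof. by move=> F G FG; apply/val_inj/eqP; rewrite eqEsubset. Qed.

Lemma pcp_le_trans : transitive pcp_le.
Proof. by move=> G F H; apply: subset_trans. Qed.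

Fact pcp_display : Order.disp_t. Proof. exact: Order.Disp tt tt. Qed.

HB.instance Definition _ := Order.Le_isPOrder.Build pcp_display pcp
  pcp_le_refl pcp_le_anti pcp_le_trans.

Record pcpm := PCPm { pcpm_face :> pcp; pcpm_neq0 : pcp_set pcpm_face != set0 }.

HB.instance Definition _ := [isSub of pcpm for pcpm_face].
HB.instance Definition _ := [Finite of pcpm by <:].
HB.instance Definition _ := [SubChoice_isSubPOrder of pcpm by <:
  with pcp_display].

Lemma pcpm_ltE (F G : pcpm) : (F < G)%O = (pcp_set F \proper pcp_set G).
Proof.
rewrite lt_neqAle properEneq -(inj_eq val_inj) -(inj_eq val_inj) /=.
by congr (_ && _); rewrite leEsub.
Qed.

(* Cardinality gives the rank in pcp; the minimal elements of pcpm are the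
   vertices, and these have rank 0.                                           *)
Definition pcpm_rank (F : pcpm) : nat := #|pcp_set F|.-1.

Lemma pcpm_rank_minimal (F : pcpm) :
  (forall G : pcpm, ~~ (G < F)%O) -> pcpm_rank F = 0%N.
Proof.
move=> minF; have /set0Pn[v vF] := pcpm_neq0 F.
have sv : [set v] \subset pcp_set F by rewrite sub1set.
have v0 : pcp_set (PCP (antipode_free_sub sv (pcp_free F))) != set0.
  by apply/set0Pn; exists v; rewrite /= inE.
have := minF (PCPm v0); rewrite pcpm_ltE /= properE sv /= negbK => sF.
by apply/eqP; rewrite /pcpm_rank -subn1 subn_eq0 -(cards1 v) subset_leq_card.
Qed.

Lemma pcpm_rank_cover (F G : pcpm) : (F < G)%O ->
  (forall H : pcpm, ~~ (F < H < G)%O) -> pcpm_rank G = (pcpm_rank F).+1.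
Proof.
rewrite pcpm_ltE => /properP[sFG [v vG vF]] cov.
have sv : v |: pcp_set F \subset pcp_set G by rewrite subUset sub1set vG.
have v0 : pcp_set (PCP (antipode_free_sub sv (pcp_free G))) != set0.
  by apply/set0Pn; exists v; rewrite /= !inE eqxx.
have := cov (PCPm v0); rewrite !pcpm_ltE /= properUr ?sub1set //= properE sv /=.
rewrite negbK => sG; rewrite /pcpm_rank.
have -> : pcp_set G = v |: pcp_set F by apply/eqP; rewrite eqEsubset sG.
by rewrite cardsU1 vF /= prednK // card_gt0 pcpm_neq0.
Qed.

HB.instance Definition _ :=
  FinPOrder_isRanked.Build _ pcpm pcpm_rank_minimal pcpm_rank_cover.

(* The hyperoctahedral group, as the permutation group on the vertices generated
   by the permutations of the coordinates and the sign changes.               *)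
Definition perm_vertex_fun (s : 'S_n) (v : vertex) : vertex := (s v.1, v.2).

Lemma perm_vertex_inj s : injective (perm_vertex_fun s).
Proof. by move=> [i b] [j c] [/perm_inj-> ->]. Qed.

Definition perm_vertex (s : 'S_n) : {perm vertex} := perm (@perm_vertex_inj s).

Definition sign_change (i : 'I_n) : {perm vertex} :=
  tperm (i, false : bool) (i, true).

Definition hyperoctahedral : {group {perm vertex}} :=
  <<[set perm_vertex s | s : 'S_n] :|: [set sign_change i | i : 'I_n]>>%G.

Definition derangementsBC : nat :=
  #|[set g in hyperoctahedral | [forall v, g v != v]]|.

End CrossPolytope.

(* The chain C_n is carried by 'I_n, hence shifted to 0 < ... < n - 1. *)
Section Chain.
Variable n : nat.

Lemma ord_rank_minimal (x : 'I_n) :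
  (forall y : 'I_n, ~~ (y < x)%O) -> x = 0%N :> nat.
Proof.
move=> minx; apply/eqP; rewrite -leqn0 leqNgt.
exact: minx (Ordinal (leq_ltn_trans (leq0n x) (ltn_ord x))).
Qed.

Lemma ord_rank_cover (x y : 'I_n) : (x < y)%O ->
  (forall z : 'I_n, ~~ (x < z < y)%O) -> y = x.+1 :> nat.
Proof.
rewrite ltEord => xy cov; apply/eqP; rewrite eqn_leq xy andbT leqNgt.
apply/negP=> lt_x1y; have x1n := ltn_trans lt_x1y (ltn_ord y).
by case/negP: (cov (Ordinal x1n)); apply/andP; split; [apply: ltnSn|].
Qed.

HB.instance Definition _ :=
  FinPOrder_isRanked.Build _ 'I_n ord_rank_minimal ord_rank_cover.

End Chain.

(* Main.v *)
From HB Require Import structures.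
Require Import Defs.
From mathcomp Require Import all_boot all_order all_algebra all_fingroup.
From mathcomp Require Import reals complex.
From mathcomp Require Import zify.

(* Only the top homology is computed, and it is just the space of top cycles.
   For a chain a with elements of rank 0, ..., k-1 below a down-set D, let Z(D, k)
   be the space of cycles on such chains.  Summing over the top element maps the
   direct sum of the Z(P_{<x}, k), for x in D of rank k, to Z(D, k) with kernel
   Z(D, k+1), so
     dim Z(D, k+1) + dim Z(D, k) >= sum_x dim Z(P_{<x}, k).
   Labelling (F, q) by twice the sum of the codes of the vertices of F plus q is
   an EL-labelling of PCP_n^- * C_n.  The cycle relations bound dim Z(D, k) by the
   number of chains falling everywhere, and these numbers satisfy the opposite
   inequality, since a falling chain has a unique least extension.  Hence equality
   holds, without any information on lower homology.
   The recursion then gives sum_q dim Z(P_{<(F,q)}, k) = m (m-1) ... (m-k) for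
   m = |F|, in particular m! for k = m-1, and dim Z(P, n) is the alternating sum of
   2^j n (n-1) ... (n-j+1), which inclusion-exclusion identifies with the number of
   fixed-point-free signed permutations. *)

Set Implicit Arguments.
Unset Strict Implicit.
Unset Printing Implicit Defensive.

Import Order.TTheory GRing.Theory.

Local Open Scope ring_scope.

(** * Chains through consecutive ranks *)

Section FullChains.
Variables (d : Order.disp_t) (T : finPOrderType d) (rk : T -> nat).
Hypothesis rk_lt : forall x y : T, (x < y)%O -> (rk x < rk y)%N.

Implicit Types (D E c : {set T}) (x y z : T) (j k : nat).

Definition lower (x : T) : {set T} := [set y | (y < x)%O].

(** Ranks are distinct along a chain, so [k] elements of rank below [k] occupy each of the ranks 0,
    ..., k-1 exactly once. *)
Definition full_chain (D : {set T}) (k : nat) (c : {set T}) : bool :=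
  [&& is_chain c, c \subset D, #|c| == k & [forall x in c, (rk x < k)%N]].

Lemma is_chainP (c : {set T}) :
  reflect {in c &, forall x y, (x >=< y)%O} (is_chain c).
Proof.
apply: (iffP forall_inP) => [h x y xc yc | h x xc].
  by have /forall_inP := h x xc; apply.
by apply/forall_inP=> y; apply: h.
Qed.

Lemma full_chainP D k (c : {set T}) :
  reflect [/\ {in c &, forall x y, (x >=< y)%O}, c \subset D, #|c| = k &
              {in c, forall x, (rk x < k)%N}] (full_chain D k c).
Proof.
apply: (iffP and4P) => [[/is_chainP ? ? /eqP ? /forall_inP ?] | [? ? ? ?]] //.
by split=> //; [apply/is_chainP | apply/eqP | apply/forall_inP].
Qed.

Lemma chain_rk_inj (c : {set T}) : is_chain c -> {in c &, injective rk}.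
Proof.
move=> /is_chainP ch x y xc yc e.
by case: (comparable_ltgtP (ch x y xc yc)) => // /rk_lt; rewrite e ltnn.
Qed.

Lemma chain_ltE (c : {set T}) x y : is_chain c -> x \in c -> y \in c ->
  (x < y)%O = (rk x < rk y)%N.
Proof.
move=> /is_chainP ch xc yc.
case: (comparable_ltgtP (ch x y xc yc)) => [/rk_lt -> | /rk_lt /ltnW | ->] //.
  by rewrite leqNgt => /negbTE.
by rewrite ltnn.
Qed.

Lemma full_chain_chain D k c : full_chain D k c -> is_chain c.
Proof. by case/and4P. Qed.

Lemma full_chain_sub D k c x : full_chain D k c -> x \in c -> x \in D.
Proof. by case/and4P=> _ /subsetP s _ _; apply: s. Qed.

Lemma full_chain_card D k c : full_chain D k c -> #|c| = k.
Proof. by case/and4P=> _ _ /eqP. Qed.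

Lemma full_chain_rk D k c x : full_chain D k c -> x \in c -> (rk x < k)%N.
Proof. by case/and4P=> _ _ _ /forall_inP; apply. Qed.

(** An injection between sets of equal size is onto. The type ['I_k.-1.+1] is inhabited even for [k]
    = 0, as [inord] requires. *)
Lemma full_chain_rk_image D k c : full_chain D k c ->
  [set (inord (rk x) : 'I_k.-1.+1) | x in c] = [set i : 'I_k.-1.+1 | (i < k)%N].
Proof.
case: k => [|k] fc.
  move/eqP: (full_chain_card fc); rewrite cards_eq0 => /eqP->.
  by rewrite imset0; apply/setP=> i; rewrite !inE.
have -> : [set i : 'I_k.+1 | (i < k.+1)%N] = setT.
  by apply/setP=> i; rewrite !inE ltn_ord.
apply/eqP; rewrite eqEcard subsetT cardsT card_ord /=.
rewrite card_in_imset ?(full_chain_card fc) //.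
move=> x y xc yc /(congr1 val) /=; rewrite !inordK ?(full_chain_rk fc) //.
exact: chain_rk_inj (full_chain_chain fc) _ _ xc yc.
Qed.

Lemma full_chain_rk_ex D k c j : full_chain D k c -> (j < k)%N ->
  exists2 x, x \in c & rk x = j.
Proof.
case: k => // k fc jk; have := full_chain_rk_image fc.
move/setP/(_ (Ordinal jk)); rewrite !inE /= jk => /imsetP[x xc /(congr1 val)/= e].
by exists x => //; rewrite inordK ?(full_chain_rk fc) in e.
Qed.

Lemma full_chain_top D k c x : full_chain D k.+1 c -> x \in c -> rk x = k ->
  full_chain (lower x) k (c :\ x).
Proof.
move=> fc xc rx; have ch := full_chain_chain fc; have /is_chainP chP := ch.
have rk_ne y : y \in c -> y != x -> (rk y < k)%N.
  move=> yc yx; rewrite ltn_neqAle -ltnS (full_chain_rk fc) // andbT.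
  by apply: contra yx => /eqP e; apply/eqP/(chain_rk_inj ch); rewrite // e rx.
apply/full_chainP; split.
- by move=> y z /setD1P[_ yc] /setD1P[_ zc]; apply: chP.
- apply/subsetP=> y /setD1P[yx yc]; rewrite inE (chain_ltE ch) // rx.
  exact: rk_ne.
- by have := full_chain_card fc; rewrite (cardsD1 x) xc => -[].
- by move=> y /setD1P[yx yc]; apply: rk_ne.
Qed.

Definition down_closed (D : {set T}) :=
  forall x y, (x < y)%O -> y \in D -> x \in D.

Lemma lower_down_closed x : down_closed (lower x).
Proof. by move=> y z yz; rewrite !inE; apply: lt_trans. Qed.

Lemma full_chain_addtop D k c x : down_closed D -> x \in D -> rk x = k ->
  full_chain (lower x) k c -> full_chain D k.+1 (x |: c).
Proof.
move=> Dd xD rx fc; have /is_chainP chP := full_chain_chain fc.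
have ltx y : y \in c -> (y < x)%O.
  by move=> yc; have := full_chain_sub fc yc; rewrite inE.
apply/full_chainP; split.
- move=> y z /setU1P[->|yc] /setU1P[->|zc].
  + exact: comparablexx.
  + by apply: gt_comparable; apply: ltx.
  + by apply: lt_comparable; apply: ltx.
  + exact: chP.
- apply/subsetP=> y /setU1P[->|/ltx yx] //; exact: Dd yx xD.
- rewrite cardsU1 (full_chain_card fc) -[k.+1]add1n; congr (_ + _)%N.
  by case xc: (x \in c) => //; have := ltx x xc; rewrite ltxx.
- move=> y /setU1P[->|yc]; first by rewrite rx.
  exact: ltnW (full_chain_rk fc yc).
Qed.

Lemma full_chain_widen D E k c : (forall x, x \in c -> x \in D -> x \in E) ->
  full_chain D k c -> full_chain E k c.
Proof.
move=> sDE /and4P[? /subsetP cD ? ?]; apply/and4P; split=> //.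
by apply/subsetP=> x xc; apply: sDE; last exact: cD.
Qed.

Lemma full_chain_lower D k c x : down_closed D -> x \in D ->
  full_chain (lower x) k c -> full_chain D k c.
Proof.
move=> Dd xD; apply: full_chain_widen => y _; rewrite inE => yx; exact: Dd yx xD.
Qed.

Lemma full_chain_ext_rk D E k c x : full_chain D k c ->
  full_chain E k.+1 (x |: c) -> x \notin c /\ rk x = k.
Proof.
move=> fc fxc; have := full_chain_card fxc.
rewrite cardsU1 (full_chain_card fc); case xc: (x \in c) => /=.
  by rewrite add0n => /eqP; rewrite -[X in X == _]addn0 -addn1 eqn_add2l.
have [y /setU1P[->|yc] ry] := full_chain_rk_ex fxc (ltnSn k); first by split.
by have := full_chain_rk fc yc; rewrite ry ltnn.
Qed.

Lemma full_chain_ext D E k c x : full_chain D k c ->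
  full_chain E k.+1 (x |: c) ->
  [/\ x \notin c, rk x = k, x \in E & full_chain (lower x) k c].
Proof.
move=> fc fxc; have [xc rx] := full_chain_ext_rk fc fxc.
have xxc : x \in x |: c by rewrite setU11.
split=> //; first exact: full_chain_sub fxc xxc.
by have := full_chain_top fxc xxc rx; rewrite setU1K.
Qed.

(** By cardinality the replacement is new, and only [y] can fill the rank left vacant by [z]. *)
Lemma full_chain_swap_rk D k c z y : full_chain D k c -> z \in c ->
  full_chain D k (y |: (c :\ z)) -> y \notin c :\ z /\ rk y = rk z.
Proof.
move=> fc zc fyc.
have yc : y \notin c :\ z.
  have := full_chain_card fyc; have := full_chain_card fc.
  rewrite (cardsD1 z) zc cardsU1 => <-.
  by case: (y \in _) => //= /eqP; rewrite eqn_add2r.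
split=> //; have [x xyc rx] := full_chain_rk_ex fyc (full_chain_rk fc zc).
case/setU1P: xyc rx => [->//|/setD1P[xz xc] e].
by rewrite (chain_rk_inj (full_chain_chain fc) xc zc e) eqxx in xz.
Qed.

End FullChains.

(** * Cycle spaces *)

Lemma dim_le_card (K : fieldType) (X : finType)
    (U : {vspace {ffun X -> K^o}}) (N : {set X}) :
  (forall f, f \in U -> (forall x, x \in N -> f x = 0) -> f = 0) ->
  (\dim U <= #|N|)%N.
Proof.
move=> inj.
pose r (f : {ffun X -> K^o}) : 'rV[K]_#|N| := \row_i f (enum_val i).
have rL : semilinear r.
  by split=> [a f|f g]; apply/rowP=> i; rewrite !mxE !ffunE.
pose rP := GRing.isSemilinear.Build K _ _ _ r rL.
pose R : {linear {ffun X -> K^o} -> 'rV[K]_#|N|} := HB.pack r rP.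
rewrite -(limg_dim_eq (f := linfun R)).
  by apply: leq_trans (dimvS (subvf _)) _; rewrite dimvf /dim /= mul1n.
apply/eqP; rewrite -subv0; apply/subvP=> f; rewrite memv_cap memv0 memv_ker.
case/andP=> fU; rewrite lfunE /= => /eqP/rowP e; apply/eqP/inj => // x xN.
by have := e (enum_rank_in xN x); rewrite !mxE enum_rankK_in.
Qed.

Section CycleSpaces.
Variables (K : fieldType) (d : Order.disp_t) (T : finPOrderType d).
Variable rk : T -> nat.
Hypothesis rk_lt : forall x y : T, (x < y)%O -> (rk x < rk y)%N.
Implicit Types (D E c e : {set T}) (x y z : T) (j k : nat).

Local Notation full_chain := (full_chain rk).
Local Notation V := {ffun {set T} -> K^o}.

(** The boundary map without signs, retained only at sets satisfying [Q]. On full chains the sign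
    depends only on the missing rank, so dropping it does not change the kernel. Functions on all
    subsets of [T] give one ambient space for every [D] and [k]. *)
Definition coface_sum_fun (Q : pred {set T}) (a : V) : V :=
  [ffun e : {set T} => if Q e then \sum_(y | y \notin e) a (y |: e) else 0].

Lemma coface_sum_is_semilinear Q : semilinear (coface_sum_fun Q).
Proof.
split=> [l a|a b]; apply/ffunP=> e; rewrite !ffunE; case: ifP => _.
- by rewrite scaler_sumr; apply: eq_bigr => y _; rewrite ffunE.
- by rewrite scaler0.
- by rewrite -big_split; apply: eq_bigr => y _; rewrite ffunE.
- by rewrite addr0.
Qed.

HB.instance Definition _ Q :=
  GRing.isSemilinear.Build K V V _ (coface_sum_fun Q) (coface_sum_is_semilinear Q).

Definition vanish_on_fun (Q : pred {set T}) (a : V) : V :=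
  [ffun c : {set T} => if Q c then 0 else a c].

Lemma vanish_on_is_semilinear Q : semilinear (vanish_on_fun Q).
Proof.
split=> [l a|a b]; apply/ffunP=> e; rewrite !ffunE; case: ifP => _ //.
- by rewrite scaler0.
- by rewrite addr0.
Qed.

HB.instance Definition _ Q :=
  GRing.isSemilinear.Build K V V _ (vanish_on_fun Q) (vanish_on_is_semilinear Q).

(** On chains below [x] this is the linear extension of adjoining [x] as a new top. *)
Definition lift_fun (x : T) (a : V) : V :=
  [ffun c : {set T} => if x \in c then a (c :\ x) else 0].

Lemma lift_is_semilinear x : semilinear (lift_fun x).
Proof.
split=> [l a|a b]; apply/ffunP=> e; rewrite !ffunE; case: ifP => _ //.
- by rewrite scaler0.
- by rewrite addr0.
Qed.

HB.instance Definition _ x :=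
  GRing.isSemilinear.Build K V V _ (lift_fun x) (lift_is_semilinear x).

Definition supported D k : {vspace V} := lker (linfun (vanish_on_fun (full_chain D k))).

Definition has_rk k : pred {set T} := fun e => [exists x in e, rk x == k].

Definition cycle_space D k : {vspace V} :=
  (supported D k :&: lker (linfun (coface_sum_fun predT)))%VS.

(* An e of top rank k lacks a lower rank: the cycle conditions that move the
   top element are dropped. *)
Definition nontop_cycle_space D k : {vspace V} :=
  (supported D k.+1 :&: lker (linfun (coface_sum_fun (has_rk k))))%VS.

Lemma supportedP D k (a : V) :
  reflect (forall c, a c != 0 -> full_chain D k c) (a \in supported D k).
Proof.
rewrite memv_ker lfunE /=; apply: (iffP eqP) => [/ffunP h c | h].
  by have := h c; rewrite !ffunE; case: ifP => // _ ->; rewrite eqxx.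
apply/ffunP=> c; rewrite !ffunE; case: ifP => // fc.
by apply/eqP; apply: contraFT fc; apply: h.
Qed.

Lemma coface_sum0P (Q : pred {set T}) (a : V) :
  reflect (forall e, Q e -> \sum_(y | y \notin e) a (y |: e) = 0)
          (a \in lker (linfun (coface_sum_fun Q))).
Proof.
rewrite memv_ker lfunE /=; apply: (iffP eqP) => [/ffunP h e Qe | h].
  by have := h e; rewrite !ffunE Qe.
by apply/ffunP=> e; rewrite !ffunE; case: ifP => // /h.
Qed.

Lemma cycle_spaceP D k (a : V) :
  reflect ((forall c, a c != 0 -> full_chain D k c) /\
           (forall e, \sum_(y | y \notin e) a (y |: e) = 0))
          (a \in cycle_space D k).
Proof.
rewrite memv_cap; apply: (iffP andP) => [[/supportedP h /coface_sum0P g]|[h g]].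
  by split=> // e; apply: g.
by split; [apply/supportedP | apply/coface_sum0P => e _].
Qed.

Lemma nontop_cycle_spaceP D k (a : V) :
  reflect ((forall c, a c != 0 -> full_chain D k.+1 c) /\
    (forall e, has_rk k e -> \sum_(y | y \notin e) a (y |: e) = 0))
          (a \in nontop_cycle_space D k).
Proof.
rewrite memv_cap; apply: (iffP andP) => [[/supportedP h /coface_sum0P g]|[h g]] //.
by split; [apply/supportedP | apply/coface_sum0P; apply: g].
Qed.

Lemma nontop_cycle_space_ker D k :
  (nontop_cycle_space D k :&:
    lker (linfun (coface_sum_fun (predC (has_rk k)))))%VS = cycle_space D k.+1.
Proof.
apply/vspaceP=> a; rewrite memv_cap; apply/andP/cycle_spaceP.
  case=> /nontop_cycle_spaceP[h g] /coface_sum0P g'; split=> // e.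
  by case hk: (has_rk k e); [apply: g | apply: g'; rewrite /= hk].
by case=> h g; split; [apply/nontop_cycle_spaceP | apply/coface_sum0P].
Qed.

(** After exchanging two sums, the relation of the image at [e] becomes the sum of the relations of
    [a] at [y |: e] over [y] of rank [k]; each of these is imposed in [nontop_cycle_space]. *)
Lemma nontop_cycle_space_img D k : down_closed D ->
  (linfun (coface_sum_fun (predC (has_rk k))) @: nontop_cycle_space D k <= cycle_space D k)%VS.
Proof.
move=> Dd; apply/subvP=> _ /memv_imgP[a /nontop_cycle_spaceP[sa ra] ->]; rewrite lfunE /=.
have rkn c x y : a c != 0 -> x \in c -> y \in c -> rk x = k -> rk y = k -> x = y.
  move=> /sa/full_chain_chain ch xc yc rx ry.
  by apply: (chain_rk_inj rk_lt ch); rewrite // rx.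
apply/cycle_spaceP; split=> e.
  rewrite ffunE; case: ifP => [/= nk | _]; last by rewrite eqxx.
  apply: contraNT => nf; apply/eqP/big1 => y ye.
  apply: contraNeq nf => /sa fc.
  have [x xc rx] := full_chain_rk_ex rk_lt fc (ltnSn k).
  have xy : x = y.
    case/setU1P: xc => // xe; case/negP: nk.
    by apply/exists_inP; exists x; rewrite ?rx.
  rewrite xy in rx; have yc : y \in y |: e by rewrite setU11.
  have := full_chain_top rk_lt fc yc rx; rewrite setU1K //.
  by apply: full_chain_lower => //; apply: full_chain_sub fc yc.
case he: (has_rk k e).
  apply: big1 => y ye; rewrite ffunE /=; case: ifP => // /negP[].
  have /exists_inP[x xe rx] := he.
  by apply/exists_inP; exists x => //; rewrite setU1r.
(* The coefficient of [a] on [e] with a top [y] and a further element [w] added. Summing over [y]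
   first gives the image, summing over [w] first gives the relations of [a]. *)
pose F y w := if (y \notin e) && (rk y == k) && (w \notin y |: e)
  then a (w |: (y |: e)) else 0.
transitivity (\sum_w \sum_y F y w).
  rewrite [LHS]big_mkcond; apply: eq_bigr => w _ /=; case: ifP => we; last first.
    rewrite big1 // => y _; rewrite /F inE negb_or.
    by move/negbFE: we => ->; rewrite !andbF.
  rewrite ffunE /=; case: ifP => [nk|/negbFE].
    rewrite big_mkcond; apply: eq_bigr => y _; rewrite /F !inE !negb_or we andbT.
    rewrite [w == y]eq_sym; case yw: (y == w) => /=; first by rewrite andbF.
    rewrite andbT; case ye: (y \in e) => //=.
    rewrite setUCA; case ry: (rk y == k) => //.
    apply/eqP; apply: contraFT ry => /sa fc.
    have [x xc rx] := full_chain_rk_ex rk_lt fc (ltnSn k).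
    have xy : x = y.
      rewrite setUCA in xc.
      case/setU1P: xc => // xe; case/negP: nk.
      by apply/exists_inP; exists x; rewrite ?rx.
    by rewrite -xy rx.
  (* Here [w] itself has rank [k]; a nonzero term would be a chain with two distinct elements of
     that rank. *)
  move=> hw; have /exists_inP[x /setU1P[-> /eqP rw | xe rx]] := hw; last first.
    by case/negP: (negbT he); apply/exists_inP; exists x.
  rewrite big1 // => y _; rewrite /F; case: ifP => // /andP[/andP[ye /eqP ry] wy].
  apply/eqP; apply: contraNT wy => nz.
  by rewrite (rkn _ _ _ nz _ _ rw ry) !inE ?eqxx ?orbT.
rewrite exchange_big /= big1 // => y _; rewrite -big_mkcond /=.
case: (boolP ((y \notin e) && (rk y == k))) => [/andP[ye ry]|_]; last first.
  by rewrite big_pred0.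
apply: ra; apply/exists_inP; exists y => //; exact: setU11.
Qed.

(** If [x] is in [e], the relation at [e] is that of [f] at [e :\ x], whose extra term [f e] is
    zero. Otherwise every nontrivial term evaluates [f] at a set containing another element of rank
    [k], where [f] vanishes. *)
Lemma lift_nontop_cycle_space D k x : down_closed D -> x \in D -> rk x = k ->
  (linfun (lift_fun x) @: cycle_space (lower x) k <= nontop_cycle_space D k)%VS.
Proof.
move=> Dd xD rx; apply/subvP=> _ /memv_imgP[f /cycle_spaceP[sf rf] ->].
rewrite lfunE /=; apply/nontop_cycle_spaceP; split=> e.
  rewrite ffunE; case: ifP => xe; last by rewrite eqxx.
  by move/sf=> fe; rewrite -(setD1K xe); apply: full_chain_addtop.
case/exists_inP=> x' x'e /eqP rx'.
have nf c : x' \in c -> f c = 0.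
  move=> x'c; apply: contraTeq x'c => /sf fc; apply/negP=> x'c.
  by have := full_chain_rk fc x'c; rewrite rx' ltnn.
case xe: (x \in e); last first.
  rewrite big1 // => y ye; rewrite ffunE; case: ifP => // /setU1P[_|]; last by rewrite xe.
  by rewrite nf // !inE x'e orbT andbT; apply: contraFN xe => /eqP <-.
rewrite -[RHS](rf (e :\ x)) [RHS](bigD1 x) ?inE ?eqxx //=.
rewrite setD1K // [f e]nf // add0r; apply: eq_big => [y|y ye].
  rewrite !inE negb_and negbK; case: eqVneq => [->|] //=; last by rewrite andbT.
  by rewrite xe.
rewrite ffunE !inE xe orbT; congr (f _); apply/setP=> z; rewrite !inE.
case: (eqVneq z y) => [->|] //=; rewrite andbT.
by apply: contraNneq ye => ->.
Qed.

Lemma lift_dim k x : \dim (linfun (lift_fun x) @: cycle_space (lower x) k)%VS =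
  \dim (cycle_space (lower x) k).
Proof.
apply: limg_dim_eq; apply/eqP; rewrite -subv0; apply/subvP=> f.
rewrite memv_cap memv0 memv_ker lfunE /= => /andP[/cycle_spaceP[sf _] /eqP/ffunP e].
apply/eqP/ffunP=> c; rewrite ffunE; apply/eqP.
apply: contraT => nz; have := e (x |: c); rewrite !ffunE setU11 setU1K => [/eqP|].
  by rewrite (negbTE nz).
by apply: contraTN nz => xc; apply/negP=> /sf/full_chain_sub/(_ xc); rewrite inE ltxx.
Qed.

(** Lifts from distinct [x] of rank [k] have disjoint supports, since a lifted chain has only [x] at
    rank [k]; so their sum is direct. *)
Lemma nontop_cycle_space_dim_ge D k : down_closed D ->
  (\sum_(x in D | rk x == k) \dim (cycle_space (lower x) k)
    <= \dim (nontop_cycle_space D k))%N.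
Proof.
move=> Dd; pose U x := (linfun (lift_fun x) @: cycle_space (lower x) k)%VS.
have dU : directv (\sum_(x in D | rk x == k) U x)%VS.
  apply/directv_sum_independent => us uU us0 x /andP[xD /eqP rx].
  have [f fZ uf] := memv_imgP (uU x (introT andP (conj xD (introT eqP rx)))).
  suff f0 : f = 0 by rewrite uf f0 linear0.
  have [sf _] := cycle_spaceP _ _ _ fZ; apply/ffunP=> c; rewrite ffunE.
  apply/eqP; apply: contraT => nz.
  have fc := sf _ nz; have xc : x \notin c.
    by apply/negP=> /(full_chain_sub fc); rewrite inE ltxx.
  have /ffunP/(_ (x |: c)) := us0; rewrite sum_ffunE ffunE (bigD1 x) /=; last first.
    by rewrite xD rx eqxx.
  rewrite big1 ?addr0; last first.
    move=> y /andP[/andP[yD /eqP ry] yx].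
    have [g gZ ->] := memv_imgP (uU y (introT andP (conj yD (introT eqP ry)))).
    rewrite lfunE /= ffunE; case: ifP => // /setU1P[e|yc]; first by rewrite e eqxx in yx.
    by have := full_chain_rk fc yc; rewrite ry ltnn.
  by rewrite uf lfunE /= ffunE setU11 setU1K // => /eqP; rewrite (negbTE nz).
have <- : \dim (\sum_(x in D | rk x == k) U x)%VS =
    (\sum_(x in D | rk x == k) \dim (cycle_space (lower x) k))%N.
  by rewrite (directvP dU) /=; apply: eq_bigr => x _; rewrite lift_dim.
by apply/dimvS/subv_sumP=> x /andP[xD /eqP rx]; apply: lift_nontop_cycle_space.
Qed.

(** Rank-nullity for the removal of the top element on [nontop_cycle_space]. *)
Lemma cycle_space_dim_ge D k : down_closed D ->
  (\sum_(x in D | rk x == k) \dim (cycle_space (lower x) k)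
    <= \dim (cycle_space D k.+1) + \dim (cycle_space D k))%N.
Proof.
move=> Dd; apply: leq_trans (nontop_cycle_space_dim_ge k Dd) _.
rewrite -(limg_ker_dim (linfun (coface_sum_fun (predC (has_rk k))))).
rewrite nontop_cycle_space_ker leq_add2l.
exact/dimvS/nontop_cycle_space_img.
Qed.

Lemma cycle_space0_dim D : (1 <= \dim (cycle_space D 0))%N.
Proof.
pose f : V := [ffun c : {set T} => if c == set0 then 1 else 0].
have <- : \dim <[f]>%VS = 1%N.
  rewrite dim_vline; case: eqVneq => // /ffunP/(_ set0)/eqP.
  by rewrite !ffunE eqxx oner_eq0.
apply: dimvS; rewrite -memvE; apply/cycle_spaceP; split=> [c|e].
  rewrite ffunE; case: (eqVneq c set0) => [-> _|]; last by rewrite eqxx.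
  by apply/full_chainP; split; rewrite ?sub0set ?cards0 // => x; rewrite inE.
rewrite big1 // => y _; rewrite ffunE; case: (eqVneq (y |: e) set0) => // /setP/(_ y).
by rewrite !inE eqxx.
Qed.

End CycleSpaces.

(** * Falling chains *)

Section FallingChains.
Variables (K : fieldType) (d : Order.disp_t) (T : finPOrderType d).
Variable rk : T -> nat.
Hypothesis rk_lt : forall x y : T, (x < y)%O -> (rk x < rk y)%N.
Variable l : T -> nat.
Implicit Types (D E c e : {set T}) (x y z : T) (j k m : nat).

Local Notation full_chain := (full_chain rk).
Local Notation cycle_space := (cycle_space K rk).

(** A descent stated without edge labels: among the elements that can take the place of [z] in [c],
    [z] is not the strict minimum of [l]. *)
Definition falling_at D k c z := [exists y,
  [&& y != z, full_chain D k (y |: (c :\ z)) & (l y <= l z)%N]].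

Definition falling D k : {set {set T}} :=
  [set c | full_chain D k c && [forall z in c, falling_at D k c z]].

(* A cycle relation expresses its value on a chain that does not fall at z by
   its values on chains of larger total label. *)
Lemma cycle_space_dim_le D k : (\dim (cycle_space D k) <= #|falling D k|)%N.
Proof.
apply: dim_le_card => f /cycle_spaceP[sf rf] f0; apply/ffunP=> c0; rewrite ffunE.
apply/eqP; apply: contraT => nz0.
case: (@arg_maxnP _ c0 (fun c => f c != 0) (fun c => \sum_(x in c) l x)%N nz0).
move=> c nz maxc; have fc := sf c nz.
have : c \notin falling D k by apply: contra nz => /f0 ->.
rewrite inE fc /= negb_forall_in => /exists_inP[z zc /existsPn nfall].
case/eqP: nz; rewrite -[RHS](rf (c :\ z)) (bigD1 z) ?inE ?eqxx //= setD1K //.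
rewrite big1 ?addr0 // => y /andP[yc yz]; apply/eqP; apply: contraT => nzy.
have := nfall y; rewrite yz (sf _ nzy) /= -ltnNge => lzy.
have := maxc _ nzy; rewrite big_setU1 //= (big_setD1 z zc) /= leq_add2r.
by rewrite leqNgt lzy.
Qed.

(* The last two conditions make l an EL-labelling: labels separate the
   extensions of a chain, and a chain that falls when z is compared with all
   alternatives still falls at z after its least extension by y. *)
Record regular D m : Prop := Regular {
  reg_down : down_closed D;
  reg_ext : forall k c, (k < m)%N -> full_chain D k c ->
    exists y, full_chain D k.+1 (y |: c);
  reg_inj : forall k c y y', full_chain D k c -> full_chain D k.+1 (y |: c) ->
    full_chain D k.+1 (y' |: c) -> l y = l y' -> y = y';
  reg_swap : forall k c z z1 y, full_chain D k c ->
    full_chain D k.+1 (z |: c) -> full_chain D k.+1 (z1 |: c) ->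
    z1 != z -> (l z1 <= l z)%N -> full_chain D k.+2 (y |: (z |: c)) ->
    (forall y', full_chain D k.+2 (y' |: (z |: c)) -> (l y <= l y')%N) ->
    exists z2, [/\ z2 != z, full_chain D k.+2 (y |: (z2 |: c)) &
                   (l z2 <= l z)%N] }.

Lemma card_bigcup_le (I : finType) (J : finType) (P : pred I) (F : I -> {set J}) :
  (#|\bigcup_(i | P i) F i| <= \sum_(i | P i) #|F i|)%N.
Proof.
elim/big_ind2: _ => [|A1 n1 A2 n2 h1 h2|//]; first by rewrite cards0.
exact: leq_trans (leq_card_setU _ _) (leq_add h1 h2).
Qed.

Definition inner_falling D k : {set {set T}} := [set c | full_chain D k.+1 c &&
  [forall z in c, (rk z != k) ==> falling_at D k.+1 c z]].

(** A replacement at a lower rank keeps the top [x], hence lies below it, so deleting [x] leaves a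
    chain falling in [lower x]. *)
Lemma inner_falling_le D k :
  (#|inner_falling D k| <= \sum_(x in D | rk x == k) #|falling (lower x) k|)%N.
Proof.
apply: leq_trans (_ : (\sum_(x in D | rk x == k)
    #|[set x |: c | c in falling (lower x) k]| <= _)%N); last first.
  by apply: leq_sum => x _; apply: leq_imset_card.
apply: leq_trans (card_bigcup_le _ _).
apply/subset_leq_card/subsetP=> c; rewrite inE => /andP[fc /forall_inP fall].
have [x xc rx] := full_chain_rk_ex rk_lt fc (ltnSn k).
apply/bigcupP; exists x; first by rewrite rx eqxx (full_chain_sub fc).
apply/imsetP; exists (c :\ x); last by rewrite setD1K.
rewrite inE (full_chain_top rk_lt fc) //=; apply/forall_inP=> z /setD1P[zx zc].
have rz : rk z != k.
  apply: contra zx => /eqP rz.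
  by apply/eqP/(chain_rk_inj rk_lt (full_chain_chain fc)); rewrite // rx.
have /existsP[y /and3P[yz fy lyz]] := implyP (fall z zc) rz.
have [yc ry] := full_chain_swap_rk rk_lt fc zc fy.
have xy : x != y by apply: contraNneq rz => xy; rewrite -ry -xy rx.
apply/existsP; exists y; rewrite yz lyz andbT /=.
have := full_chain_top rk_lt fy _ rx.
rewrite !inE [x == z]eq_sym (negbTE zx) xc orbT => /(_ isT).
congr full_chain; apply/setP=> t; rewrite !inE.
case: (eqVneq t x) => [->|tx] //=.
by rewrite (negbTE xy) andbF.
Qed.

(** * Least extensions of falling chains *)

Definition min_ext D k c := [pick y | full_chain D k.+1 (y |: c) &&
  [forall y', full_chain D k.+1 (y' |: c) ==> (l y <= l y')%N]].

(** The default [c] is never taken on full chains when [D] is regular and [k] < [m], by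
    [extendP]. *)
Definition extend D k c := if min_ext D k c is Some y then y |: c else c.

Lemma extendP D m k c : regular D m -> (k < m)%N -> full_chain D k c ->
  exists y, [/\ extend D k c = y |: c, full_chain D k.+1 (y |: c) &
    forall y', full_chain D k.+1 (y' |: c) -> (l y <= l y')%N].
Proof.
move=> reg km fc; rewrite /extend /min_ext; case: pickP => [y|none].
  by case/andP=> fy /forallP h; exists y; split=> // y' /(implyP (h y')).
have [y0 fy0] := reg_ext reg km fc.
case: (@arg_minnP _ y0 (fun y => full_chain D k.+1 (y |: c)) l fy0) => y fy h.
by have := none y; rewrite fy /= => /forallP[] y'; apply/implyP/h.
Qed.

(** A replacement for a non-top element of [c] stays below the new top [y], because it is below the
    top of [c]. A replacement for the top of [c] need not lie below [y]; there [reg_swap] provides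
    another one. *)
Lemma extend_inner D m k c : regular D m -> (k < m)%N -> c \in falling D k ->
  extend D k c \in inner_falling D k.
Proof.
move=> reg km; rewrite inE => /andP[fc /forall_inP fall].
have [y [-> fy miny]] := extendP reg km fc.
have [yc ry yD fyc] := full_chain_ext rk_lt fc fy.
rewrite inE fy /=; apply/forall_inP=> z /setU1P[->|zc]; first by rewrite ry eqxx.
apply/implyP=> _; have yz : y != z by apply: contraNneq yc => ->.
have -> : falling_at D k.+1 (y |: c) z = [exists w,
  [&& w != z, full_chain D k.+1 (y |: (w |: (c :\ z))) & (l w <= l z)%N]].
  apply: eq_existsb => w; congr [&& _, full_chain _ _ _ & _].
  rewrite setUCA; congr (_ |: _); apply/setP=> t; rewrite !inE.
  by case: (eqVneq t y) => [->|] //=; rewrite yz.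
have /existsP[w /and3P[wz fw lwz]] := fall z zc.
have [wc rw] := full_chain_swap_rk rk_lt fc zc fw.
case: k km fc fy fall miny ry fyc fw => [|k] km fc fy fall miny ry fyc fw.
  by have := full_chain_rk fc zc.
case: (eqVneq (rk z) k) => rz.
  have fC : full_chain D k (c :\ z).
    apply: full_chain_lower (reg_down reg) (full_chain_sub fc zc) _.
    exact: (full_chain_top rk_lt fc zc rz).
  have [|||||z2 [z2z fz2 lz2]] := reg_swap reg (z := z) (y := y) fC _ fw => //.
  - by rewrite setD1K.
  - by rewrite setD1K.
  - by move=> y'; rewrite setD1K //; apply: miny.
  by apply/existsP; exists z2; apply/and3P.
apply/existsP; exists w; rewrite wz lwz andbT /=.
apply: (full_chain_addtop (reg_down reg)) => //.
have [x xc rx] := full_chain_rk_ex rk_lt fc (ltnSn k).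
have xw : x \in w |: (c :\ z).
  apply/setU1P; right; rewrite !inE xc andbT.
  by apply: contraNneq rz => <-; rewrite rx.
have lty t : t \in c -> (t < y)%O.
  by move=> tc; have := full_chain_sub fyc tc; rewrite inE.
apply: full_chain_widen (fw) => t tw _; rewrite inE.
case/setU1P: tw => [->|/setD1P[_ /lty //]].
apply: lt_trans (lty x xc).
rewrite (chain_ltE rk_lt (full_chain_chain fw)) ?setU11 // rw rx ltn_neqAle rz.
by rewrite -ltnS (full_chain_rk fc).
Qed.

(** Falling chains of size [k.+1] and least extensions of those of size [k] both lie in
    [inner_falling D k]. They are disjoint: by [reg_inj] the top of a least extension is the strict
    minimum, so the chain does not fall there. *)
Lemma falling_card_le D m k : regular D m -> (k < m)%N ->
  (#|falling D k.+1| + #|falling D k|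
    <= \sum_(x in D | rk x == k) #|falling (lower x) k|)%N.
Proof.
move=> reg km; apply: leq_trans (inner_falling_le D k).
have full c : c \in falling D k -> full_chain D k c by rewrite inE => /andP[].
(* [extend] is injective here: the added element is recovered as the one of rank [k]. *)
have <- : #|[set extend D k c | c in falling D k]| = #|falling D k|.
  rewrite card_in_imset // => c1 c2 /full f1 /full f2.
  have [y1 [-> fy1 _]] := extendP reg km f1.
  have [y2 [-> fy2 _]] := extendP reg km f2 => e.
  have [n1 r1] := full_chain_ext_rk rk_lt f1 fy1.
  have [n2 r2] := full_chain_ext_rk rk_lt f2 fy2.
  have e12 : y1 = y2.
    apply: (chain_rk_inj rk_lt (full_chain_chain fy1)); rewrite ?setU11 ?r1 //.
    by rewrite e setU11.
  by rewrite -(setU1K n1) e e12 setU1K.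
rewrite -cardsUI.
have -> : falling D k.+1 :&: [set extend D k c | c in falling D k] = set0.
  apply/setP=> c; rewrite !inE; apply/negP=> /andP[/andP[_ /forall_inP fall]].
  case/imsetP=> c' /full fc' ec; have [y [e fy miny]] := extendP reg km fc'.
  have [yc ry] := full_chain_ext_rk rk_lt fc' fy.
  rewrite e in ec; rewrite ec in fall.
  have /existsP[w /and3P[wy]] := fall y (setU11 _ _).
  rewrite setU1K // => fw lwy; case/eqP: wy.
  by apply: (reg_inj reg fc' fw fy); apply/eqP; rewrite eqn_leq lwy miny.
rewrite cards0 addn0; apply/subset_leq_card; rewrite subUset; apply/andP; split.
  apply/subsetP=> c; rewrite !inE => /andP[-> /forall_inP fall] /=.
  by apply/forall_inP=> z zc; apply/implyP=> _; apply: fall.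
by apply/subsetP=> _ /imsetP[c cN ->]; apply: (extend_inner reg km).
Qed.

Lemma falling0_card D : (#|falling D 0| <= 1)%N.
Proof.
rewrite -(cards1 (set0 : {set T})); apply/subset_leq_card/subsetP=> c.
rewrite !inE => /andP[/full_chain_card/eqP].
by rewrite cards_eq0.
Qed.

Lemma cycle_space_dim0 D : \dim (cycle_space D 0) = 1%N.
Proof.
apply/eqP; rewrite eqn_leq cycle_space0_dim andbT.
exact: leq_trans (cycle_space_dim_le D 0) (falling0_card D).
Qed.

Hypothesis reg_lower : forall x, regular (lower x) (rk x).

(** By induction the sums over [x] in [falling_card_le] and [cycle_space_dim_ge] agree, so the two
    inequalities chain together; cancelling the equal terms at [k] gives the missing lower bound on
    the dimension. *)
Lemma cycle_space_dimE D m k : regular D m -> (k <= m)%N ->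
  \dim (cycle_space D k) = #|falling D k|.
Proof.
elim: k D m => [|k IH] D m reg km.
  apply/eqP; rewrite eqn_leq cycle_space_dim_le cycle_space_dim0.
  exact: falling0_card.
apply/eqP; rewrite eqn_leq cycle_space_dim_le -(leq_add2r #|falling D k|).
apply: leq_trans (falling_card_le reg km) _.
rewrite -(IH D m) ?(ltnW km) //.
apply: leq_trans (cycle_space_dim_ge _ rk_lt k (reg_down reg)).
apply: leq_sum => x /andP[xD /eqP rx]; rewrite (IH _ (rk x)) ?rx //.
by rewrite -rx; apply: reg_lower.
Qed.

Lemma cycle_space_dim_rec D m k : regular D m -> (k < m)%N ->
  (\dim (cycle_space D k.+1) + \dim (cycle_space D k) =
    \sum_(x in D | rk x == k) \dim (cycle_space (lower x) k))%N.
Proof.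
move=> reg km; apply/eqP; rewrite eqn_leq (cycle_space_dim_ge _ rk_lt k (reg_down reg)) andbT.
rewrite (cycle_space_dimE reg km) (cycle_space_dimE reg (ltnW km)).
apply: leq_trans (falling_card_le reg km) _.
apply: leq_sum => x /andP[xD /eqP rx]; rewrite (cycle_space_dimE (reg_lower x)) //.
by rewrite rx.
Qed.

End FallingChains.

(** * Top homology *)

Section TopHomology.
Variables (K : fieldType) (d : Order.disp_t) (T : finPOrderType d).
Variable rk : T -> nat.
Hypothesis rk_lt : forall x y : T, (x < y)%O -> (rk x < rk y)%N.
Variable m : nat.
Hypothesis rk_le : forall x : T, (rk x <= m)%N.
Implicit Types (c e : {set T}) (x y z : T) (j k : nat).

Lemma face_full c : is_chain c && (#|c| == m.+1) = full_chain rk setT m.+1 c.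
Proof.
rewrite /full_chain subsetT /=; congr (_ && _); case: eqP => //= _.
by apply/esym/forall_inP=> x _; rewrite ltnS.
Qed.

(** Ranks embed a chain into [m.+1] values, so the incoming boundary in degree [m] is zero. *)
Lemma no_face : face T m.+2 -> False.
Proof.
case=> c /andP[ch /eqP cc].
have : (#|[set (inord (rk x) : 'I_m.+1) | x in c]| <= m.+1)%N.
  by rewrite -[X in (_ <= X)%N]card_ord max_card.
rewrite card_in_imset ?cc ?ltnn // => x y xc yc /(congr1 val) /=.
by rewrite !inordK ?ltnS // => /(chain_rk_inj rk_lt ch); apply.
Qed.

Lemma boundaries_top : boundaries K T m = 0%VS.
Proof.
apply/eqP; rewrite -subv0; apply/subvP=> _ /memv_imgP[a _ ->].
rewrite memv0 lfunE /=; apply/eqP/ffunP=> e; rewrite !ffunE.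
by apply: big1 => c; have := no_face c.
Qed.

Lemma below_rk c x : full_chain rk setT m.+1 c -> x \in c ->
  Defs.below c x = rk x.
Proof.
move=> fc xc; have ch := full_chain_chain fc.
pose r y : 'I_m.+1 := inord (rk y).
have rv y : val (r y) = rk y by rewrite /= inordK // ltnS.
transitivity #|[set i : 'I_m.+1 | (i < rk x)%N]|; last first.
  rewrite -sum1dep_card -(big_ord_widen _ (fun=> 1%N)) ?sum1_card ?card_ord //.
  exact: leq_trans (rk_le x) (leqnSn m).
rewrite /Defs.below -(card_in_imset (f := r)); last first.
  move=> y z; rewrite !inE => /andP[yc _] /andP[zc _] /(congr1 val).
  by rewrite !rv => /(chain_rk_inj rk_lt ch); apply.
congr #|pred_of_set _|; apply/setP=> i; rewrite inE; apply/imsetP/idP.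
  case=> y; rewrite inE => /andP[yc yx] ->.
  by rewrite [nat_of_ord _]rv -(chain_ltE rk_lt ch).
move=> ix; have [y yc ry] := full_chain_rk_ex rk_lt fc (ltn_ord i).
exists y; last by apply: val_inj; rewrite rv.
by rewrite inE yc (chain_ltE rk_lt ch) // ry.
Qed.

(** This recovers the rank of a deleted element from the remaining ones, as the sign in
    [bd_chain_fun] requires. *)
Lemma sum_rk c : full_chain rk setT m.+1 c ->
  (\sum_(x in c) rk x = \sum_(i < m.+1) i)%N.
Proof.
move=> fc; have ch := full_chain_chain fc.
pose r y : 'I_m.+1 := inord (rk y).
have rv y : val (r y) = rk y by rewrite /= inordK // ltnS.
transitivity (\sum_(i in [set r x | x in c]) i)%N.
  rewrite big_imset /=; last first.
    move=> y z yc zc /(congr1 val).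
    by rewrite !rv => /(chain_rk_inj rk_lt ch); apply.
  by apply: eq_bigr => x _; rewrite [nat_of_ord _]rv.
have -> : [set r x | x in c] = setT.
  apply/setP=> i; rewrite inE; apply/imsetP.
  have [y yc ry] := full_chain_rk_ex rk_lt fc (ltn_ord i).
  by exists y => //; apply: val_inj; rewrite rv.
by apply: eq_bigl => i; rewrite inE.
Qed.

Definition chain_fun (a : schain K T m.+1) : {ffun {set T} -> K^o} :=
  [ffun c : {set T} => oapp a 0 (insub c)].

Lemma chain_fun_is_semilinear : semilinear chain_fun.
Proof.
split=> [l a|a b]; apply/ffunP=> c; rewrite !ffunE; case: insub => [f|] /=.
- by rewrite ffunE.
- by rewrite scaler0.
- by rewrite ffunE.
- by rewrite addr0.
Qed.

HB.instance Definition _ :=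
  GRing.isSemilinear.Build K (schain K T m.+1) {ffun {set T} -> K^o} _
    chain_fun chain_fun_is_semilinear.

Lemma chain_funE a (c : face T m.+1) : chain_fun a (face_set c) = a c.
Proof. by rewrite ffunE valK. Qed.

Lemma chain_fun_full a c : chain_fun a c != 0 -> full_chain rk setT m.+1 c.
Proof.
rewrite -face_full ffunE; case: insubP => [f -> //|_] /=; by rewrite eqxx.
Qed.

(* The sign (-1)^below only depends on the rank missing from e. *)
Lemma bd_chain_fun a (e : face T m) :
  bd_fun a e = (-1) ^+ (\sum_(i < m.+1) i - \sum_(x in face_set e) rk x)%N *
    \sum_(y | y \notin face_set e) chain_fun a (y |: face_set e).
Proof.
rewrite ffunE mulr_sumr.
transitivity (\sum_(c : face T m.+1) \sum_(y | y \notin face_set e)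
   if y |: face_set e == face_set c
   then (-1) ^+ (\sum_(i < m.+1) i - \sum_(x in face_set e) rk x)%N * a c else 0).
  apply: eq_bigr => c _; rewrite -big_mkcondr; apply: eq_big => [x|x].
    apply/andP/andP=> [[xc /eqP <-]|[xe /eqP <-]].
      by rewrite !inE eqxx setD1K.
    by rewrite setU11 setU1K.
  case/andP=> xc /eqP ec; congr (_ ^+ _ * _).
  have fc : full_chain rk setT m.+1 c by rewrite -face_full; apply: face_chain.
  by rewrite (below_rk fc xc) -(sum_rk fc) (big_setD1 x) //= ec addnK.
rewrite exchange_big /=; apply: eq_bigr => y ye; rewrite -big_mkcond /= ffunE.
case: insubP => [c fc ec|nf] /=.
  rewrite (big_pred1 c) // => c'; rewrite /= -ec; apply/eqP/eqP=> [/val_inj-> //|-> //].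
rewrite mulr0 big_pred0 // => c; apply: contraNF nf => /eqP ->; exact: face_chain.
Qed.

Lemma cycles_img : (linfun chain_fun @: cycles K T m)%VS = cycle_space K rk setT m.+1.
Proof.
apply/vspaceP=> f; apply/memv_imgP/cycle_spaceP.
  case=> a; rewrite memv_ker lfunE /= => /eqP bd0 ->; rewrite lfunE /=.
  split=> [c|e]; first exact: chain_fun_full.
  case: (boolP (is_chain e && (#|e| == m))) => fe; last first.
    apply: big1 => y ye; apply: contraNeq fe => /chain_fun_full.
    rewrite -face_full => /andP[/is_chainP ch]; rewrite cardsU1 ye add1n eqSS => ->.
    by rewrite andbT; apply/is_chainP=> s t se te; apply: ch; rewrite setU1r.
  have := bd_chain_fun a (Face fe); rewrite bd0 ffunE => /esym/eqP.
  by rewrite mulf_eq0 signr_eq0 => /eqP.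
case=> sf rf; exists [ffun c : face T m.+1 => f (face_set c)].
  rewrite memv_ker lfunE /=; apply/eqP/ffunP=> e; rewrite bd_chain_fun ffunE.
  apply/eqP; rewrite mulf_eq0 signr_eq0 /=; apply/eqP.
  rewrite -[RHS](rf e); apply: eq_bigr => y ye.
  rewrite ffunE; case: insubP => [c _ <-|nf] /=; first by rewrite ffunE.
  by apply/esym/eqP; apply: contraNT nf => /sf; rewrite -face_full.
rewrite lfunE /=; apply/ffunP=> c; rewrite ffunE.
case: insubP => [c' _ <-|nf] /=; first by rewrite ffunE.
by apply/eqP; apply: contraNT nf => /sf; rewrite -face_full.
Qed.

Lemma top_homology_dim :
  reduced_homology_dim K T m = \dim (cycle_space K rk setT m.+1).
Proof.
rewrite /reduced_homology_dim /reduced_homology dimvf /dim /=.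
rewrite -cycles_img limg_dim_eq.
  by rewrite -[RHS](dimv_cap_compl _ (boundaries K T m)) boundaries_top capv0 dimv0.
apply/eqP; rewrite -subv0; apply/subvP=> a; rewrite memv_cap memv0 memv_ker lfunE /=.
case/andP=> _ /eqP/ffunP a0; apply/eqP/ffunP=> c; rewrite ffunE -chain_funE.
by rewrite a0 ffunE.
Qed.

End TopHomology.

(** * The EL-labelling of the Rees product *)

Section ReesCrossPolytope.
Variable n : nat.
Local Notation T := (rees (pcpm n) 'I_n).
Implicit Types (D : {set T}) (c : {set T}) (u v w x y z : T) (k s : nat).
Implicit Types (G A : {set vertex n}) (a b : vertex n).

Definition rface u : {set vertex n} := pcp_set (pcpm_face (rees_pair u).1).
Definition rheight u : nat := (rees_pair u).2.
Definition rrank u : nat := #|rface u|.-1.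

Lemma rface_free u : antipode_free (rface u).
Proof. exact: pcp_free. Qed.

Lemma rface_neq0 u : rface u != set0.
Proof. exact: pcpm_neq0. Qed.

Lemma rface_card u : #|rface u| = (rrank u).+1.
Proof. by rewrite prednK // card_gt0 rface_neq0. Qed.

Lemma rheight_lt u : (rheight u < #|rface u|)%N.
Proof. by rewrite rface_card ltnS; apply: (rees_rank u). Qed.

Lemma rees_inj u v : rface u = rface v -> rheight u = rheight v -> u = v.
Proof.
move=> f h; apply: val_inj; move: f h.
case: u v => -[[[A hA] hA0] i] hi [[[[B hB] hB0] j] hj].
rewrite /rface /rheight /= => AB ij; congr pair; last exact: val_inj.
by do 2!apply: val_inj.
Qed.

Lemma rees_leE u v : (u <= v)%O = [&& rface u \subset rface v,
  (rheight u <= rheight v)%N &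
  (rheight v + #|rface u| <= rheight u + #|rface v|)%N].
Proof.
have := rface_card u; have := rface_card v.
case: u v => -[p i] hi [[q j] hj]; rewrite /rrank /rface /rheight /= => cv cu.
rewrite [LHS]/Order.le /= /rees_le /=; congr [&& _, _ & _].
by rewrite /prank /= /pcpm_rank /=; lia.
Qed.

Lemma free_card_le G : antipode_free G -> (#|G| <= n)%N.
Proof.
move=> /forallP fG; rewrite -[n in (_ <= n)%N]card_ord.
rewrite -(card_in_imset (f := fun a : vertex n => a.1)) ?max_card //.
move=> [i b] [j b'] aG bG /= ij; subst j; congr pair.
have := fG i; case: b b' aG bG => [] [] // -> ->; by [].
Qed.

Lemma rees_ex G s : antipode_free G -> (s < #|G|)%N ->
  exists2 u, rface u = G & rheight u = s.
Proof.
move=> fG sG.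
have G0 : G != set0 by rewrite -card_gt0; apply: leq_ltn_trans sG.
have sn := leq_trans sG (free_card_le fG).
have h : (prank (Ordinal sn) <= prank (PCPm (pcpm_face := PCP fG) G0))%N.
  by rewrite /prank /= /pcpm_rank /= -ltnS prednK // card_gt0.
by exists (@Rees _ _ (pcpm n) 'I_n (PCPm (pcpm_face := PCP fG) G0, Ordinal sn) h).
Qed.

(** If the faces agree, the rank condition forces equal heights, so a strict inequality must enlarge
    the face. *)
Lemma rees_ltE u v : (u < v)%O =
  [&& rface u \subset rface v, (rheight u <= rheight v)%N,
   (rheight v + #|rface u| <= rheight u + #|rface v|)%N &
   (#|rface u| < #|rface v|)%N].
Proof.
rewrite lt_neqAle rees_leE.
case sf: (rface u \subset rface v); rewrite ?andbF //=.
case: (leqP #|rface v| #|rface u|) => cuv.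
  have e : rface u = rface v by apply/eqP; rewrite eqEcard sf.
  rewrite !andbF e; apply/negP=> /and3P[uv h1 h2]; case/eqP: uv.
  apply: rees_inj => //; lia.
rewrite !andbT; case: eqVneq => //= e; by rewrite e ltnn in cuv.
Qed.

Lemma rrank_lt u v : (u < v)%O -> (rrank u < rrank v)%N.
Proof. by rewrite rees_ltE !rface_card ltnS => /and4P[]. Qed.

Lemma rrank_bound u : (rrank u < n)%N.
Proof. by rewrite -rface_card free_card_le ?rface_free. Qed.

(* Unbarred vertices come first, so that a barred vertex never has the least
   code among the vertices that extend a given face. *)
Definition vcode a : nat := (a.2 * n + a.1)%N.

Lemma vcode_inj : injective vcode.
Proof.
move=> [i b] [j b']; rewrite /vcode /= => e.
have := ltn_ord i; have := ltn_ord j; case: b b' e => [] [] /= e hi hj; try lia.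
all: by congr pair; apply: val_inj => /=; lia.
Qed.

(** The heights of the extensions of a fixed chain take at most two consecutive values, so the
    factor 2 makes their order lexicographic: added vertex first, then height. *)
Definition rlabel u : nat := (2 * (\sum_(a in rface u) vcode a) + rheight u)%N.

Lemma card_setU1_ex G A : G \subset A -> #|A| = #|G|.+1 ->
  exists2 a, a \notin G & A = a |: G.
Proof.
move=> GA cA; have /cards1P[a e] : #|A :\: G| == 1%N.
  by rewrite cardsD (setIidPr GA) cA subSnn.
have : a \in A :\: G by rewrite e set11.
rewrite inE => /andP[aG aA]; exists a => //.
by rewrite setUC -e setDE setUIr setUCr setIT; apply/esym/setUidPr.
Qed.

Local Notation full_chain := (full_chain rrank).
Local Notation regular := (regular rrank rlabel).

(** Only the top [z] constrains [y], and one rank up in the Rees product the height stays or rises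
    by one. *)
Lemma full_chain_over D k c z : down_closed D -> full_chain D k.+1 c ->
  z \in c -> rrank z = k -> forall y, full_chain D k.+2 (y |: c) =
  [&& y \in D, #|rface y| == k.+2, rface z \subset rface y &
      (rheight z <= rheight y <= (rheight z).+1)%N].
Proof.
move=> Dd fc zc rz y; have cz := rface_card z; rewrite rz in cz.
apply/idP/and4P=> [fy | [yD /eqP cy zy /andP[h1 h2]]].
  have [yc ry yD fyc] := full_chain_ext rrank_lt fc fy.
  have := full_chain_sub fyc zc; rewrite inE rees_ltE => /and4P[-> h1 h2 h3].
  have cy := rface_card y; rewrite ry in cy.
  split=> //; first by rewrite cy.
  by rewrite h1 /=; lia.
have ry : rrank y = k.+1 by have := rface_card y; lia.
have zy' : (z < y)%O by rewrite rees_ltE zy cy cz; lia.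
apply: (full_chain_addtop Dd yD ry).
apply: full_chain_widen (fc) => w wc _; rewrite inE.
case: (eqVneq w z) => [->|wz] //; apply: lt_trans zy'.
rewrite (chain_ltE rrank_lt (full_chain_chain fc)) // rz ltn_neqAle.
rewrite -ltnS (full_chain_rk fc) // andbT; apply: contra wz => /eqP rw.
by apply/eqP/(chain_rk_inj rrank_lt (full_chain_chain fc)); rewrite // rz.
Qed.

(* (G, s) is the last element of c, with (set0, 0) for the empty chain. *)
Lemma full_chain_base D k c : down_closed D -> full_chain D k c ->
  exists G s, [/\ #|G| = k, antipode_free G, (s <= k.-1)%N,
    (k = 0%N /\ s = 0%N) \/ (exists w, [/\ w \in D, rface w = G & rheight w = s]) &
    forall z, full_chain D k.+1 (z |: c) =
     [&& z \in D, #|rface z| == k.+1, G \subset rface z &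
         (s <= rheight z <= s.+1)%N]].
Proof.
case: k => [|k] Dd fc.
  exists set0, 0%N; split=> //; rewrite ?cards0 //; [|by left|].
    by apply/forallP=> i; rewrite !inE.
  move=> z; have -> : c = set0.
    by apply/eqP; rewrite -cards_eq0 (full_chain_card fc).
  have := rheight_lt z; rewrite sub0set /= setU0 => hz.
  apply/idP/and3P=> [f|[zD /eqP cz h]].
    have zz := set11 z; have := full_chain_rk f zz; rewrite rface_card in hz *.
    by split; [exact: full_chain_sub f zz | lia | lia].
  apply/full_chainP; split; rewrite ?cards1 ?sub1set // => u.
    by move=> v /set1P-> /set1P->; apply: comparablexx.
  by move=> /set1P->; rewrite /rrank cz.
have [w wc rw] := full_chain_rk_ex rrank_lt fc (ltnSn k).
exists (rface w), (rheight w); split.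
- by rewrite rface_card rw.
- exact: rface_free.
- by have := rheight_lt w; rewrite rface_card rw.
- by right; exists w; split=> //; apply: full_chain_sub fc wc.
- exact: full_chain_over.
Qed.

Lemma full_chain_base2 D k c z : down_closed D -> full_chain D k c ->
  full_chain D k.+1 (z |: c) -> forall y, full_chain D k.+2 (y |: (z |: c)) =
  [&& y \in D, #|rface y| == k.+2, rface z \subset rface y &
      (rheight z <= rheight y <= (rheight z).+1)%N].
Proof.
move=> Dd fc fz; have [_ rz] := full_chain_ext_rk rrank_lt fc fz.
by apply: full_chain_over; rewrite ?setU11.
Qed.

(** The last two hypotheses cover the two cases of [reg_swap]: [z1] has the face of [z] and a
    smaller height, or it adds a vertex of smaller code. *)
Lemma regular_rees D m : down_closed D ->
  (forall k c, (k < m)%N -> full_chain D k c ->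
    exists y, full_chain D k.+1 (y |: c)) ->
  (forall z1 z y y', z1 \in D -> z \in D -> y \in D -> rface z1 = rface z ->
    rheight z = (rheight z1).+1 -> #|rface y| = #|rface z|.+1 ->
    rface y' = rface y -> rheight y' = rheight z -> y' \in D) ->
  (forall z1 z y G a a1, z1 \in D -> z \in D -> y \in D ->
    rface z = a |: G -> rface z1 = a1 |: G -> a1 \notin rface z ->
    (vcode a1 < vcode a)%N -> rface z \subset rface y ->
    #|rface y| = #|rface z|.+1 ->
    exists y' b, [/\ y' \in D, rface y' = b |: rface z, rheight y' = rheight y,
      b \notin rface z & (vcode b < vcode a)%N]) ->
  regular D m.
Proof.
move=> Dd ext F1 F2; split=> //.
  move=> k c y y' fc; have [G [s [cG _ _ _ base]]] := full_chain_base Dd fc.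
  rewrite !base -cG => /and4P[_ /eqP cy Gy hy] /and4P[_ /eqP cy' Gy' hy'].
  have [a aG ey] := card_setU1_ex Gy cy; have [a' aG' ey'] := card_setU1_ex Gy' cy'.
  rewrite /rlabel ey ey' !big_setU1 //= => e.
  have /vcode_inj ea : vcode a = vcode a' by lia.
  by apply: rees_inj; [rewrite ey ey' ea | rewrite ea in e; lia].
move=> k c z z1 y fc fz fz1 z1z lz1 fy miny.
have base2 := full_chain_base2 Dd fc.
have [G [s [cG _ _ _ base]]] := full_chain_base Dd fc.
have := fz1; have := fz; rewrite !base => /and4P[zD /eqP cz Gz hz].
case/and4P=> z1D /eqP cz1 Gz1 hz1.
have miny' w : w \in D -> #|rface w| = k.+2 -> rface z \subset rface w ->
    (rheight z <= rheight w <= (rheight z).+1)%N -> (rlabel y <= rlabel w)%N.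
  by move=> wD cw zw hw; apply: miny; rewrite base2 // wD cw eqxx zw hw.
move: fy; rewrite (base2 z fz) => /and4P[yD /eqP cy zy hy].
have [|a aG ez] := card_setU1_ex Gz _; first by rewrite cG.
have [|a1 aG1 ez1] := card_setU1_ex Gz1 _; first by rewrite cG.
have [|b bz ey] := card_setU1_ex zy _; first by rewrite cz.
have hz_lt := rheight_lt z; rewrite cz in hz_lt.
have lzE : rlabel z = (2 * (vcode a + \sum_(a in G) vcode a) + rheight z)%N.
  by rewrite /rlabel ez big_setU1.
have lz1E : rlabel z1 = (2 * (vcode a1 + \sum_(a in G) vcode a) + rheight z1)%N.
  by rewrite /rlabel ez1 big_setU1.
(* With equal faces, [z1] is one lower than [z]. Comparing [y] with the element of the same face at
   the height of [z] shows that [y] has that height, so [z1] itself lies below [y]. *)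
case: (eqVneq a1 a) => [e|a1a].
  rewrite e in ez1 lz1E.
  have zz1 : rface z1 = rface z by rewrite ez ez1.
  have hne : rheight z1 != rheight z.
    by apply: contra z1z => /eqP h; apply/eqP/rees_inj.
  have hzS : rheight z = (rheight z1).+1.
    by move: lz1 hne hz hz1; rewrite lzE lz1E; clear; lia.
  have [|y' ey' hy'] := rees_ex (s := rheight z) (rface_free y).
    by rewrite cy; apply: ltnW.
  have y'D : y' \in D by apply: (F1 z1 z y); rewrite ?cy ?cz.
  have lyy' : (rlabel y <= rlabel y')%N.
    by apply: miny'; rewrite ?ey' ?hy' ?leqnn //=.
  exists z1; split=> //; rewrite (base2 z1 fz1) yD cy eqxx zz1 zy /=.
  by move: lyy' hy hzS; rewrite /rlabel ey' hy'; clear; lia.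
(* With different vertices, minimality of [y] against [y'] makes the vertex [b] added by [y] smaller
   than [a]. Adding [b] before [a] gives [z2], of smaller label and still below [y]. *)
have la : (vcode a1 < vcode a)%N.
  have : vcode a1 != vcode a by apply: contra a1a => /eqP/vcode_inj->.
  by move: lz1 hz hz1; rewrite lzE lz1E; clear; lia.
have a1z : a1 \notin rface z by rewrite ez !inE negb_or a1a.
have [|y' [b' [y'D ey' hy' bz' lb']]] := F2 z1 z y G a a1 z1D zD yD ez ez1 a1z la zy _.
  by rewrite cy cz.
have lyy' : (rlabel y <= rlabel y')%N.
  apply: miny'; rewrite ?hy' //; rewrite ey' ?subsetUr //.
  by rewrite cardsU1 bz' cz.
have lb : (vcode b < vcode a)%N.
  by move: lyy' lb'; rewrite /rlabel ey ey' hy' !big_setU1 //=; clear; lia.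
have bG : b \notin G by apply: contra bz => /(subsetP Gz).
have bGy : b |: G \subset rface y.
  by rewrite ey setUS.
have cbG : #|b |: G| = k.+1 by rewrite cardsU1 bG cG.
have [|z2 ez2 hz2] := rees_ex (s := rheight z) (antipode_free_sub bGy (rface_free y)).
  by rewrite cbG.
have z2y : (z2 < y)%O by rewrite rees_ltE ez2 bGy cbG cy hz2; move: hy; clear; lia.
have z2D := Dd _ _ z2y yD.
have fz2 : full_chain D k.+1 (z2 |: c).
  by rewrite base z2D ez2 cbG eqxx subsetUr hz2.
exists z2; split.
- by apply: contraNneq bz => <-; rewrite ez2 setU11.
- by rewrite (base2 z2 fz2) yD cy eqxx ez2 bGy hz2.
- by rewrite lzE /rlabel ez2 hz2 big_setU1 //=; move: lb; clear; lia.
Qed.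

Lemma regular_lower x : regular (lower x) (rrank x).
Proof.
have Dd := @lower_down_closed _ _ x.
have cx := rface_card x.
apply: regular_rees => //.
- move=> k c kx fc; have [G [s [cG fG sk wG base]]] := full_chain_base Dd fc.
  have hx := rheight_lt x.
  have [Gx sx hs] : [/\ G \subset rface x, (s <= rheight x)%N &
      (rheight x + k <= s + #|rface x|)%N /\
      (rheight x + k = s + #|rface x| -> 0 < k)%N].
    case: wG => [[k0 s0]|[w [wD ew hw]]].
      have -> : G = set0 by apply/eqP; rewrite -cards_eq0 cG k0.
      by rewrite sub0set; split=> //; lia.
    move: wD; rewrite inE rees_ltE ew hw cG => /and4P[-> -> h1 h2]; split=> //.
    have := rface_card w; rewrite ew cG; lia.
  have /subsetPn[a ax aG] : ~~ (rface x \subset G).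
    by apply: contraTN kx => /subset_leq_card; rewrite cG cx; lia.
  have aGx : a |: G \subset rface x by rewrite subUset sub1set ax.
  have caG : #|a |: G| = k.+1 by rewrite cardsU1 aG cG.
  (* The height has to rise exactly when the height gap to [x] already equals the gap in
     cardinality. *)
  pose e := (rheight x + k == s + #|rface x|)%N.
  have [|y ey hy] := rees_ex (s := s + e) (antipode_free_sub aGx (rface_free x)).
    by rewrite caG /e; case: eqP hs => //= h hs; lia.
  exists y; rewrite base inE rees_ltE ey hy caG aGx subsetUr eqxx /=.
  by rewrite cx; move: hs; rewrite /e cx; case: eqP => h /= hs; lia.
- move=> z1 z y y'; rewrite !inE !rees_ltE => /and4P[_ h1 h2 h3] /and4P[_ h4 h5 h6].
  case/and4P=> yx h7 h8 h9 e1 e2 e3 e4 e5; rewrite e4 e5 yx h4 h9 /= andbT.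
  by rewrite e3 e2 addSn addnS ltnS -e1.
- move=> z1 z y G a a1; rewrite !inE !rees_ltE => /and4P[z1x _ _ _] /and4P[zx _ _ _].
  case/and4P=> yx h1 h2 h3 ez ez1 a1z la zy cy.
  (* Below [x] the vertex [a1] itself can be added to [z], because the faces of [z] and [z1] both
     lie in the face of [x]. *)
  have a1x : a1 |: rface z \subset rface x.
    by rewrite subUset zx sub1set (subsetP z1x) // ez1 setU11.
  have ca1 : #|a1 |: rface z| = #|rface y| by rewrite cardsU1 a1z cy.
  have [|y' ey' hy'] := rees_ex (s := rheight y) (antipode_free_sub a1x (rface_free x)).
    by rewrite ca1 rheight_lt.
  by exists y', a1; split=> //; rewrite inE rees_ltE ey' hy' ca1 a1x h1 h2 h3.
Qed.

Lemma free_setU1 G i : antipode_free G ->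
  (i, false) \notin G -> (i, true) \notin G -> antipode_free ((i, false) |: G).
Proof.
move=> /forallP fG n0 n1; apply/forallP=> j; rewrite !inE !xpair_eqE !andbF /= andbT.
by case: (eqVneq j i) => [->|_] /=; [rewrite (negbTE n1) | apply: fG].
Qed.

Lemma free_ex_index G : antipode_free G -> (#|G| < n)%N ->
  exists i, (i, false) \notin G /\ (i, true) \notin G.
Proof.
move=> fG cG; have [i iG] : exists i, i \notin [set a.1 | a in G].
  apply/existsP; rewrite -negb_forall; apply: contraTN cG => /forallP h.
  rewrite -leqNgt -[X in (X <= _)%N]card_ord.
  apply: leq_trans (leq_imset_card (fun a : vertex n => a.1) _).
  by apply/subset_leq_card/subsetP=> i _; apply: h.
by exists i; split; apply: contra iG => h; apply/imsetP; eexists; eauto.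
Qed.

Lemma regular_setT : regular setT n.
Proof.
have Dd : down_closed [set: T] by move=> *; rewrite inE.
apply: regular_rees => //; first 1 last.
- by move=> *; rewrite inE.
- move=> z1 z y G a a1 _ _ _ ez ez1 a1z la zy cy.
  have cy_n : (#|rface z| < n)%N by rewrite -cy free_card_le ?rface_free.
  suff [b [bz fb lb]] : exists b, [/\ b \notin rface z,
      antipode_free (b |: rface z) & (vcode b < vcode a)%N].
    have [|y' ey' hy'] := rees_ex (s := rheight y) fb.
      by rewrite cardsU1 bz add1n -cy rheight_lt.
    by exists y', b; split=> //; rewrite in_setT.
  case fa1: (antipode_free (a1 |: rface z)); first by exists a1.
  have a2 : a.2.
    case: a a1 ez ez1 a1z la fa1 => [i [//|]] [j b] ez ez1 a1z la.
    move/negP; case; have := rface_free z; have := rface_free z1.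
    have b0 : b = false.
      move: la; rewrite /vcode /=; case: b {ez1 a1z} => //=.
      by have := ltn_ord i; lia.
    rewrite {}b0 in ez1 a1z la *; rewrite ez ez1 => /forallP f1 /forallP f.
    apply/forallP=> t; have := f1 t; have := f t; rewrite !inE !xpair_eqE !andbF /=.
    case: (eqVneq t j) => //= _; by case: (eqVneq t i) => //= _; rewrite ?andbT.
  have [i [i0 i1]] := free_ex_index (rface_free z) cy_n.
  exists (i, false); split=> //; first exact: free_setU1 (rface_free z) i0 i1.
  by rewrite /vcode /= a2; have := ltn_ord i; lia.
- move=> k c kn fc; have [G [s [cG fG sk wG base]]] := full_chain_base Dd fc.
  rewrite -cG in kn; have [i [i0 i1]] := free_ex_index fG kn.
  have cG1 : #|(i, false) |: G| = k.+1 by rewrite cardsU1 i0 cG.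
  have [|y ey hy] := rees_ex (s := s) (free_setU1 fG i0 i1); first by rewrite cG1; lia.
  by exists y; rewrite base inE ey hy cG1 eqxx subsetUr leqnn leqnSn.
Qed.

End ReesCrossPolytope.

(** * Dimensions of the cycle spaces *)

Section Counting.
Variables (K : fieldType) (n : nat).
Local Notation T := (rees (pcpm n) 'I_n).
Implicit Types (u v w x y z : T) (k s : nat).
Implicit Types (G A F : {set vertex n}).

Local Notation cdim k x := (\dim (cycle_space K (@rrank n) (lower x) k)).

Lemma card_ord_interval m a b : (a <= b <= m)%N ->
  #|[set i : 'I_m | (a <= i < b)%N]| = (b - a)%N.
Proof.
case/andP=> ab bm.
have card_lt c : (c <= m)%N -> #|[set i : 'I_m | (i < c)%N]| = c.
  by move=> cm; rewrite -sum1dep_card -(big_ord_widen _ (fun=> 1%N)) // sum1_card card_ord.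
have -> : [set i : 'I_m | (a <= i < b)%N] =
    [set i : 'I_m | (i < b)%N] :\: [set i : 'I_m | (i < a)%N].
  by apply/setP=> i; rewrite !inE -leqNgt.
rewrite cardsD (setIidPr _) ?card_lt ?(leq_trans ab) //.
by apply/subsetP=> i; rewrite !inE => ia; apply: leq_trans ab.
Qed.

Lemma card_over_face F a b : antipode_free F -> (a <= b <= #|F|)%N ->
  #|[set x : T | (rface x == F) && (a <= rheight x < b)%N]| = (b - a)%N.
Proof.
move=> fF /andP[ab bF].
have bn := leq_trans bF (free_card_le fF).
rewrite -(@card_ord_interval n a b) ?ab //.
rewrite -(card_in_imset (f := fun x : T => (rees_pair x).2)); last first.
  move=> x y; rewrite !inE => /andP[/eqP ex _] /andP[/eqP ey _] /(congr1 val) e.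
  by apply: rees_inj; rewrite ?ex ?ey.
congr #|pred_of_set _|; apply/setP=> i; rewrite inE; apply/imsetP/idP.
  by case=> x; rewrite inE => /andP[_ h] ->.
move=> /andP[ai ib]; have [x ex hx] := rees_ex fF (leq_trans ib bF).
by exists x; [rewrite inE ex eqxx hx ai | apply: val_inj].
Qed.

(** Sum the recursion over the heights above [F], with m = |F|. Each [w] of rank [k] with face in
    [F] lies below m - k elements over [F], so the right side is m (m-1) ... (m-k) times m - k;
    subtracting the previous term leaves the next falling factorial. *)
Lemma sum_cdim k F : antipode_free F -> (k < #|F|)%N ->
  (\sum_(x | rface x == F) cdim k x = #|F| ^_ k.+1)%N.
Proof.
elim: k F => [|k IH] F fF kF.
  under eq_bigr => x _ do rewrite (cycle_space_dim0 _ (@rrank n) (@rlabel n)).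
  rewrite ffactn1 -[RHS]subn0 -(@card_over_face F 0 #|F|) ?leqnn //.
  rewrite sum1dep_card; congr #|pred_of_set _|; apply/setP=> x; rewrite !inE.
  by case: eqVneq => //= <-; rewrite rheight_lt.
have step : (\sum_(x | rface x == F) cdim k.+1 x + \sum_(x | rface x == F) cdim k x
    = \sum_(x | rface x == F) \sum_(w in lower x | rrank w == k) cdim k w)%N.
  rewrite -big_split; apply: eq_bigr => x /eqP ex.
  apply: (cycle_space_dim_rec K (@rrank_lt n) (l := @rlabel n) (@regular_lower n)
    (@regular_lower n x)).
  by rewrite -ltnS -rface_card ex.
rewrite (IH F fF (ltnW kF)) in step.
suff e : (\sum_(x | rface x == F) \sum_(w in lower x | rrank w == k) cdim k w =
    #|F| ^_ k.+1 * (#|F| - k))%N.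
  apply/eqP; rewrite -(eqn_add2r (#|F| ^_ k.+1)) step e (ffactnSr _ k.+1) -mulnSr.
  by rewrite subnSK // ltnW.
rewrite (exchange_big_dep (fun w => (rface w \subset F) && (rrank w == k))) /=.
  2: by move=> x w /eqP<-; rewrite inE rees_ltE => /andP[/and4P[-> _ _ _] ->].
transitivity (\sum_(w | (rface w \subset F) && (rrank w == k)) cdim k w * (#|F| - k))%N.
  apply: eq_bigr => w /andP[wF /eqP rw]; have cw := rface_card w; rewrite rw in cw.
  rewrite sum_nat_const mulnC; congr (_ * _)%N.
  have hw := rheight_lt w; rewrite cw in hw.
  (* The admissible heights form an interval of length [#|F| - k] starting at [rheight w]; it fits
     below [#|F|] since [rheight w] is at most [k]. *)
  have -> : (#|F| - k = rheight w + (#|F| - k) - rheight w)%N by rewrite addnC addnK.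
  rewrite -(@card_over_face F) //; last by rewrite leq_addr; move: hw kF; clear; lia.
  rewrite -cardsE; congr #|pred_of_set _|; apply/setP=> x.
  rewrite !inE unfold_in /= rw eqxx andbT inE.
  case: eqVneq => //= ex; rewrite rees_ltE ex wF cw kF andbT /=; congr (_ && _).
  rewrite addnBA ?(ltnW (ltnW kF)) // ltn_subRL. by rewrite addnS [(k + _)%N]addnC.
rewrite -big_distrl /=; congr (_ * _)%N.
rewrite (partition_big (@rface n) (fun G => (G \subset F) && (#|G| == k.+1))) /=.
  2: by move=> w; rewrite rface_card eqSS.
transitivity (\sum_(G : {set vertex n} | (G \subset F) && (#|G| == k.+1)) k.+1 `!)%N.
  apply: eq_bigr => G /andP[GF /eqP cG].
  rewrite -ffactnn -{1}cG -IH ?cG ?(antipode_free_sub GF) //.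
  apply: eq_bigl => w; case: (eqVneq (rface w) G) => [e|]; last by rewrite andbF.
  by rewrite e GF andbT -eqSS -rface_card e cG eqxx.
by rewrite sum_nat_const -bin_ffact -cards_draws cardsE.
Qed.

(** * Antipode-free sets by support and signs *)

Definition signed_set (S B : {set 'I_n}) : {set vertex n} :=
  [set a : vertex n | (a.1 \in S) && (a.2 == (a.1 \in B))].

Lemma signed_set_card S B : #|signed_set S B| = #|S|.
Proof.
rewrite -(card_in_imset (f := fun a : vertex n => a.1)); last first.
  move=> [i b] [j c]; rewrite !inE /= => /andP[_ /eqP->] /andP[_ /eqP->] ->.
  by [].
congr #|pred_of_set _|; apply/setP=> i; apply/imsetP/idP => [[a]|iS].
  by rewrite inE => /andP[aS _] ->.
by exists (i, i \in B) => //; rewrite inE /= iS eqxx.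
Qed.

Lemma signed_set_free S B : antipode_free (signed_set S B).
Proof.
apply/forallP=> i; rewrite !inE /=; case: (i \in S) => //=.
by case: (i \in B).
Qed.

(** An antipode-free set amounts to a set of coordinates with one sign on each of them. *)
Lemma card_free j :
  #|[set F : {set vertex n} | antipode_free F && (#|F| == j)]| = (2 ^ j * 'C(n, j))%N.
Proof.
pose supp (F : {set vertex n}) := [set a.1 | a in F].
have supp_signed S B : supp (signed_set S B) = S.
  apply/setP=> i; apply/imsetP/idP => [[a]|iS].
    by rewrite inE => /andP[aS _] ->.
  by exists (i, i \in B) => //; rewrite inE /= iS eqxx.
have signedE F : antipode_free F ->
    F = signed_set (supp F) [set i | (i, true) \in F].
  move=> /forallP fF; apply/setP=> -[i b]; rewrite !inE /=.
  apply/idP/andP=> [iF|[/imsetP[[i' b'] iF /= ->]]].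
    split; first by apply/imsetP; exists (i, b).
    have := fF i; case: b iF => ->; first by [].
    by rewrite /=; case: ((i, true) \in F).
  have := fF i'; case: b' iF => iF; rewrite iF.
    by move=> _ /eqP->.
  by move=> /= /negbTE-> /eqP->.
have supp_card F : antipode_free F -> #|supp F| = #|F|.
  by move=> fF; rewrite [in RHS](signedE F fF) signed_set_card.
rewrite -sum1dep_card.
rewrite (partition_big supp (fun S : {set 'I_n} => #|S| == j)) /=; last first.
  by move=> F /andP[/supp_card->].
transitivity (\sum_(S : {set 'I_n} | #|S| == j) 2 ^ j)%N.
  apply: eq_bigr => S /eqP cS.
  transitivity #|[set signed_set S B | B in powerset S]|.
    rewrite sum1dep_card; congr #|pred_of_set _|; apply/setP=> F; rewrite inE.
    apply/andP/imsetP => [[/andP[fF _] /eqP sF]|[B _ ->]]; last first.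
      by rewrite signed_set_free signed_set_card supp_signed cS !eqxx.
    exists [set i | (i, true) \in F]; last by rewrite -sF; apply: signedE.
    rewrite inE -sF; apply/subsetP=> i; rewrite inE => iF.
    by apply/imsetP; exists (i, true).
  rewrite card_in_imset ?card_powerset ?cS //.
  move=> B B'; rewrite !inE => /subsetP BS /subsetP BS' /setP e; apply/setP=> i.
  case iS: (i \in S).
    by have := e (i, true); rewrite !inE /= iS /= => /eqP; case: (i \in B); case: (i \in B').
  have -> : (i \in B) = false by apply: contraFF iS; apply: BS.
  by apply/esym; apply: contraFF iS; apply: BS'.
rewrite sum_nat_const mulnC; congr (_ * _)%N.
by have := card_draws 'I_n j; rewrite card_ord cardsE.
Qed.

Lemma cycle_space_setT_rec k : (k < n)%N ->
  (\dim (cycle_space K (@rrank n) setT k.+1) + \dim (cycle_space K (@rrank n) setT k)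
    = 2 ^ k.+1 * n ^_ k.+1)%N.
Proof.
move=> kn.
rewrite (cycle_space_dim_rec K (@rrank_lt n) (@regular_lower n)
  (@regular_setT n) kn).
under eq_bigl => x do rewrite inE /=.
rewrite (partition_big (@rface n) (fun F => antipode_free F && (#|F| == k.+1))) /=.
  2: by move=> x; rewrite rface_card eqSS rface_free.
transitivity (\sum_(F : {set vertex n} | antipode_free F && (#|F| == k.+1)) k.+1 `!)%N.
  apply: eq_bigr => F /andP[fF /eqP cF].
  rewrite -ffactnn -{1}cF -sum_cdim ?cF //.
  apply: eq_bigl => x; case: (eqVneq (rface x) F) => [e|]; last by rewrite andbF.
  by rewrite andbT -eqSS -rface_card e cF eqxx.
by rewrite sum_nat_const -cardsE card_free -mulnA bin_ffact.
Qed.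

Lemma cycle_space_setT_dim k : (k <= n)%N ->
  (\dim (cycle_space K (@rrank n) setT k))%:Z =
  \sum_(j < k.+1) (-1) ^+ (k - j) * (2 ^ j * n ^_ j)%:Z :> int.
Proof.
elim: k => [_|k IH kn].
  by rewrite (cycle_space_dim0 _ _ (@rlabel n)) big_ord_recl big_ord0 ffactn0.
rewrite big_ord_recr /= subnn expr0 mul1r -(cycle_space_setT_rec kn) PoszD (IH (ltnW kn)).
under [X in X + _]eq_bigr => j _ do
  rewrite subSn ?leq_ord // exprS mulN1r mulNr.
by rewrite sumrN addrCA addNr addr0.
Qed.

End Counting.

(** * Signed permutations without fixed vertices *)

Section SignedPermutations.
Variable n : nat.
Local Notation V := (vertex n).
Implicit Types (s : 'S_n) (e : {ffun 'I_n -> bool}) (g : {perm V}).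

Definition signed_perm_fun s e (a : V) : V := (s a.1, a.2 (+) e a.1).

Lemma signed_perm_inj s e : injective (signed_perm_fun s e).
Proof. by move=> [i b] [j c] [/perm_inj -> /addIb ->]. Qed.

Definition signed_perm s e : {perm V} := perm (@signed_perm_inj s e).

Lemma antipode_inj : injective (fun a : V => (a.1, ~~ a.2) : V).
Proof. by move=> [i b] [j c] [-> /negb_inj ->]. Qed.

(** Commuting with this map characterizes the hyperoctahedral group among the permutations of the
    vertices. *)
Definition antipode : {perm V} := perm antipode_inj.

Lemma antipodeE (a : V) : antipode a = (a.1, ~~ a.2).
Proof. by rewrite permE. Qed.

Lemma sign_changeE (i j : 'I_n) (b : bool) :
  sign_change i (j, b) = (j, b (+) (j == i)).
Proof.
case: (eqVneq j i) => [->|ji]; last first.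
  by rewrite addbF tpermD // xpair_eqE eq_sym (negbTE ji).
by case: b; rewrite ?tpermL ?tpermR.
Qed.

Lemma hyperoctahedral_commute g : g \in hyperoctahedral n -> commute g antipode.
Proof.
suff h : hyperoctahedral n \subset ('C[antipode])%g.
  by move=> /(subsetP h) /cent1P /commute_sym.
rewrite gen_subG; apply/subsetP=> h; rewrite inE => /orP[] /imsetP[x _ ->].
  by apply/cent1P/permP=> -[i b]; rewrite !permM !permE.
apply/cent1P/permP=> -[i b]; rewrite !permM sign_changeE.
by rewrite !antipodeE sign_changeE addNb.
Qed.

(** Induction on the number of sign changes, splitting off one at a time. *)
Lemma signed_perm_hyperoctahedral s e : signed_perm s e \in hyperoctahedral n.
Proof.
have [m] := ubnP #|[set i | e i]|; elim: m e => // m IH e em.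
have [/existsP[i ei]|] := boolP [exists i, e i]; last first.
  rewrite negb_exists => /forallP e0.
  have -> : signed_perm s e = perm_vertex s.
    apply/permP=> -[i b]; rewrite !permE /signed_perm_fun /perm_vertex_fun /=.
    by rewrite (negbTE (e0 i)) addbF.
  by rewrite mem_gen // inE imset_f.
pose e' := [ffun j => (j != i) && e j].
have -> : signed_perm s e = (sign_change i * signed_perm s e')%g.
  apply/permP=> -[j b]; rewrite permM sign_changeE !permE /signed_perm_fun /= ffunE.
  by case: (eqVneq j i) => [->|ji] /=; rewrite ?ei ?addbF.
rewrite groupM ?IH //; first by rewrite mem_gen // inE imset_f ?orbT.
rewrite -ltnS; apply: leq_trans em; rewrite ltnS.
rewrite [X in (_ < X)%N](cardsD1 i) inE ei add1n ltnS.
by apply/subset_leq_card/subsetP=> j; rewrite !inE ffunE.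
Qed.

(** As [g] commutes with [antipode], it is determined by the images of the unbarred vertices, and no
    two of these images share a coordinate. *)
Lemma hyperoctahedral_signed_perm g : g \in hyperoctahedral n ->
  exists s e, g = signed_perm s e.
Proof.
move=> /hyperoctahedral_commute gA.
have gN i b : g (i, ~~ b) = ((g (i, b)).1, ~~ (g (i, b)).2).
  by have /permP/(_ (i, b)) := gA; rewrite !permM !permE.
pose f i := (g (i, false)).1.
have f_inj : injective f.
  move=> i j; rewrite /f; case ei: (g (i, false)) => [i' b].
  case ej: (g (j, false)) => [j' b'] /= ij; subst j'.
  case: (eqVneq b b') => [bb|bb].
    by subst b'; have := etrans ei (esym ej) => /perm_inj[].
  have : g (i, false) = g (j, ~~ false)
    by rewrite gN ej ei; clear -bb; case: b b' bb => [] [].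
  by move/perm_inj=> [].
exists (perm f_inj), [ffun i => (g (i, false)).2].
apply/permP=> -[i b]; rewrite permE /signed_perm_fun /= permE ffunE /f.
case: b => /=; last by case: (g (i, false)).
by rewrite -[true in LHS]/(~~ false) gN.
Qed.

Lemma signed_perm_inj2 s e s' e' : signed_perm s e = signed_perm s' e' -> s = s' /\ e = e'.
Proof.
move=> /permP h; have h' i : (s i, e i) = (s' i, e' i).
  by have := h (i, false); rewrite !permE.
by split; [apply/permP | apply/ffunP] => i; case: (h' i).
Qed.

(** A signed permutation fixes a vertex over [i] exactly when [s] fixes [i] without a sign change
    there. *)
Lemma derangementsBC_pairs : derangementsBC n =
  #|[set p : 'S_n * {ffun 'I_n -> bool} | [forall i, (p.1 i == i) ==> p.2 i]]|.
Proof.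
rewrite -(card_imset _ (f := fun p : 'S_n * {ffun 'I_n -> bool} => signed_perm p.1 p.2)).
  congr #|pred_of_set _|; apply/setP=> g; rewrite !inE.
  apply/andP/imsetP => [[/hyperoctahedral_signed_perm[s [e ->]] /forallP der]|[[s e]]].
    exists (s, e) => //; rewrite inE; apply/forallP=> i /=; apply/implyP=> /eqP si.
    have := der (i, false); rewrite permE /signed_perm_fun /= si.
    by case: (e i); rewrite // eqxx.
  rewrite inE /= => /forallP h ->; split; first exact: signed_perm_hyperoctahedral.
  apply/forallP=> -[i b]; rewrite permE /signed_perm_fun xpair_eqE /=.
  have := h i; case: eqP => //= _ ->; by case: b.
by move=> [s e] [s' e'] /= /signed_perm_inj2[-> ->].
Qed.

(** * Inclusion-exclusion over fixed coordinates *)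

Lemma card_fixing (J : {set 'I_n}) :
  #|[set s : 'S_n | [forall i in J, s i == i]]| = (n - #|J|)`!.
Proof.
have -> : (n - #|J| = #|~: J|)%N by rewrite [RHS]cardsCs setCK card_ord.
rewrite -card_perm; apply: eq_card => s; rewrite inE unfold_in.
apply/forall_inP/subsetP => [h i|h i iJ].
  by rewrite !inE; apply: contra => /h.
by apply/eqP; have := h i; rewrite !inE iJ /=; case: eqVneq => // _ /(_ isT).
Qed.

(** The sign is forced at a fixed point of [s] and free elsewhere, so each factor is 1 or 2; it is
    written as a sum in order to be expanded over subsets. *)
Lemma card_off_fixed s :
  #|[set e : {ffun 'I_n -> bool} | [forall i, (s i == i) ==> e i]]|%:Z =
  \prod_i (- (s i == i)%:Z + 2).
Proof.
transitivity (\prod_(i : 'I_n) \sum_(b : bool) ((s i == i) ==> b)%:Z); last first.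
  by apply: eq_bigr => i _; rewrite big_bool /=; case: (s i == i).
rewrite bigA_distr_bigA /= -sum1dep_card big_mkcond /=.
rewrite -natz natr_sum.
apply: eq_bigr => e _; case: forallP => [h|h] /=.
  by rewrite big1 // => i _; rewrite h.
have /existsP[i ei] : [exists i, ~~ ((s i == i) ==> e i)].
  by rewrite -negb_forall; apply/forallP.
by rewrite (bigD1 i) //= (negbTE ei) mul0r.
Qed.

(** In the expanded product, [J] is the set of coordinates where the first summand is taken; summing
    over [s] then counts the permutations fixing [J] pointwise. *)
Lemma derangementsBC_sum : (derangementsBC n)%:Z =
  \sum_(J : {set 'I_n}) (-1) ^+ #|J| * (2 ^ (n - #|J|) * (n - #|J|)`!)%:Z :> int.
Proof.
transitivity (\sum_(s : 'S_n) \prod_i (- (s i == i)%:Z + 2) : int).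
  rewrite derangementsBC_pairs -sum1dep_card.
  rewrite (eq_bigl (fun p : 'S_n * {ffun 'I_n -> bool} =>
    predT p.1 && [forall i, (p.1 i == i) ==> p.2 i])) //.
  rewrite -(pair_big_dep predT
    (fun s (e : {ffun 'I_n -> bool}) => [forall i, (s i == i) ==> e i]) (fun _ _ => 1%N)) /=.
  rewrite -natz natr_sum; apply: eq_bigr => s _.
  by rewrite sum1dep_card natz card_off_fixed.
under eq_bigr => s _ do rewrite bigA_distr.
rewrite exchange_big /=; apply: eq_bigr => J _.
transitivity (\sum_(s in [set s : 'S_n | [forall i in J, s i == i]])
    (-1) ^+ #|J| * (2 ^ (n - #|J|))%:Z : int).
  rewrite [RHS]big_mkcond; apply: eq_bigr => s _; rewrite inE.
  rewrite (bigID (mem J)) /=.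
  have -> : \prod_(i | i \notin J) (if i \in J then - (s i == i)%:Z else 2) =
      (2 ^ (n - #|J|))%:Z.
    rewrite (eq_bigr (fun=> 2)) => [|i /negbTE-> //].
    rewrite prodr_const -natz natrX; congr (_ ^+ _).
    have /(congr1 (subn^~ #|J|)) := cardC (mem J); rewrite addKn card_ord => <-.
    exact: eq_card.
  case: ifP => [/forall_inP h|].
    congr (_ * _); rewrite (eq_bigr (fun=> -1)) ?prodr_const //.
    by move=> i iJ; rewrite iJ h.
  move=> /negbT; rewrite negb_forall_in => /exists_inP[i iJ si].
  by rewrite (bigD1 i) //= iJ (negbTE si) oppr0 !mul0r.
rewrite sumr_const card_fixing -mulr_natr -mulrA PoszM; congr (_ * (_ * _)).
exact: natz.
Qed.

(** Group by the size [j] of the complement of [J]; the C(n, j) such sets, each weighted by j!,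
    produce the falling factorial. *)
Lemma derangementsBC_alt : (derangementsBC n)%:Z =
  \sum_(j < n.+1) (-1) ^+ (n - j) * (2 ^ j * n ^_ j)%:Z :> int.
Proof.
rewrite derangementsBC_sum (reindex_inj (inv_inj (@setCK _))) /=.
rewrite (partition_big (fun J : {set 'I_n} => inord #|J| : 'I_n.+1) predT) //=.
apply: eq_bigr => j _.
have cJ (J : {set 'I_n}) : (#|J| < n.+1)%N.
  by rewrite ltnS -[X in (_ <= X)%N]card_ord max_card.
rewrite (eq_bigl (fun J : {set 'I_n} => #|J| == j)); last first.
  by move=> J; rewrite -val_eqE /= inordK.
rewrite (eq_bigr (fun=> (-1) ^+ (n - j) * (2 ^ j * j`!)%:Z)); last first.
  move=> J /eqP cJj; have -> : #|~: J| = (n - j)%N.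
    by rewrite cardsCs setCK card_ord cJj.
  by rewrite subKn // -ltnS.
rewrite sumr_const -mulr_natr -mulrA; congr (_ * _).
have -> : #|[pred J : {set 'I_n} | #|J| == j]| = 'C(n, j).
  by have := card_draws 'I_n j; rewrite card_ord cardsE.
by rewrite -natz -natrM -mulnA [(j`! * _)%N]mulnC bin_ffact natz.
Qed.

End SignedPermutations.

Theorem theorem10p2 (R : realType) (n : nat) (n_ge1 : (1 <= n)%N) :
  reduced_homology_dim R[i] (rees (pcpm n) 'I_n) n.-1 = derangementsBC n.
Proof.
case: n n_ge1 => // m _ /=.
rewrite (top_homology_dim R[i] (@rrank_lt m.+1) (m := m)); last first.
  by move=> x; rewrite -ltnS rrank_bound.
by apply/eqP; rewrite -eqz_nat cycle_space_setT_dim // derangementsBC_alt.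
Qed.
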